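(* Let $f\in\mathfrak g^{\mathcal M}$, let $\beta\in D(N^* )$ (equivalently a map $\{\bullet\}\to D(N^* )$, $\bullet\mapsto\beta$) and let $\alpha\in N^*$. Then substitution with $\beta$ corresponds to substitution of Lie--Butcher series: $$\mathcal B_{\mathcal B_f(\beta)}(\alpha)=\mathcal B_f(\beta\star\alpha).$$
   Context: **Trees and forests.** $OT$ is the set of ordered (planar) rooted trees; $OF$ is the set of ordered forests, i.e. all finite words (including the empty word $\mathbb I$) in the alphabet $OT$. $\bullet$ is the one-vertex tree, $B^+:OF\to OT$ adds a common root to the trees of a word (so $B^+(\mathbb I)=\bullet$), and $|\omega|$ is the number of vertices of $\omega$. $N=\mathbb R\langle OT\rangle$ is the vector space with basis $OF$, with concatenation as associative product and unit $\mathbb I$. $N^*=\mathbb R\langle\langle OT\rangle\rangle$ is the space of infinite linear combinations $\alpha=\sum_{\omega\in OF}\alpha(\omega)\omega$. **Grafting.** $\curvearrowright:N\otimes N\to N$ is the bilinear product determined, for $\tau\in OT$, $\omega,\omega_1,\omega_2\in OF$, by $\mathbb I\curvearrowright\omega=\omega$, $\tau\curvearrowright\mathbb I=0$, $\omega\curvearrowright\bullet=B^+(\omega)$, $\tau\curvearrowright(\omega_1\omega_2)=(\tau\curvearrowright\omega_1)\omega_2+\omega_1(\tau\curvearrowright\omega_2)$, $(\tau\omega)\curvearrowright\omega_1=\tau\curvearrowright(\omega\curvearrowright\omega_1)-(\tau\curvearrowright\omega)\curvearrowright\omega_1$. It extends to $N^*$ by the grading. **Lie polynomials and series.** $D(N)$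 is the set of Lie polynomials: the smallest subspace of $N$ containing $OT$ and closed under $[x,y]=xy-yx$ (concatenation commutator). $D(N^* )$ is the set of Lie series, i.e. the elements of $N^*$ all of whose homogeneous components (with respect to $|\cdot|$) are Lie polynomials. **Substitution.** For $\beta\in D(N^* )$, the substitution map $\beta\star:N^*\to N^*$ is the unique D-algebra homomorphism sending $\bullet$ to $\beta$, i.e. the linear map (compatible with infinite sums) determined by $\beta\star\mathbb I=\mathbb I$, $\beta\star(\omega_1\omega_2)=(\beta\star\omega_1)(\beta\star\omega_2)$, $\beta\star B^+(\omega)=(\beta\star\omega)\curvearrowright\beta$. **Differential operators.** $\mathcal M$ is a smooth manifold, $\mathfrak g$ a Lie subalgebra of the Lie algebra of vector fields on $\mathcal M$, $U(\mathfrak g)$ its universal enveloping algebra, $\mathfrak g^{\mathcal M}=C^\infty(\mathcal M,\mathfrak g)\subset U(\mathfrak g)^{\mathcal M}=C^\infty(\mathcal M,U(\mathfrak g))$. For $V\in\mathfrak g$ and $\Psi\in U(\mathfrak g)^{\mathcal M}$, $V[\Psi](p)=\frac{d}{dt}\big|_{t=0}\Psi(\exp(tV)(p))$ is the Lie derivative; this is extended to an action of $U(\mathfrak g)$ by $(VW)[\Psi]=V[W[\Psi]]$ and $\mathbb I[\Psi]=\Psi$. For $g,k\in U(\mathfrak g)^{\mathcal M}$ set $g[k](p)=(g(p)[k])(p)$ and $(gk)(p)=g(p)k(p)$ (product in $U(\mathfrak g)$). **Elementary differentials and Lie--Butcher series.** For $f\in\mathfrak g^{\mathcal M}$, $\mathcal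 F_f:N\to U(\mathfrak g)^{\mathcal M}$ is the linear map with $\mathcal F_f(\mathbb I)=\mathbb I$, $\mathcal F_f(B^+(\omega))=\mathcal F_f(\omega)[f]$, $\mathcal F_f(\omega_1\omega_2)=\mathcal F_f(\omega_1)\mathcal F_f(\omega_2)$. For $\alpha\in N^*$ the Lie--Butcher series is the formal series $\mathcal B_f(\alpha)=\sum_{\omega\in OF}\alpha(\omega)\mathcal F_f(\omega)$. No convergence is considered: formal series are understood graded by $|\omega|$. Concretely, one introduces a formal parameter $h$ and reads $\mathcal B_f(\alpha)$ as $\sum_\omega h^{|\omega|}\alpha(\omega)\mathcal F_f(\omega)\in U(\mathfrak g)^{\mathcal M}[[h]]$ (i.e. $f$ is replaced by $hf$). For a Lie series $\beta$, $\tilde f=\mathcal B_f(\beta)$ is a formal vector field in $h\,\mathfrak g^{\mathcal M}[[h]]$. $\mathcal F_{\tilde f}$ is defined by the same recursion, with the operations extended $h$-linearly, and $\mathcal B_{\tilde f}(\alpha)=\sum_\omega\alpha(\omega)\mathcal F_{\tilde f}(\omega)$, an $h$-adically convergent sum. *)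

(* Defs.v *)
From HB Require Import structures.
From mathcomp Require Import all_boot all_order all_algebra.
From mathcomp Require Import all_classical all_reals all_analysis.
From mathcomp Require Import finmap ring.

Set Implicit Arguments.
Unset Strict Implicit.
Unset Printing Implicit Defensive.

Import Order.TTheory GRing.Theory Num.Theory.
Import numFieldNormedType.Exports.

Local Open Scope classical_set_scope.
Local Open Scope ring_scope.

(** * Ordered trees and forests *)

Inductive otree : Type := Bplus of seq otree.

HB.instance Definition _ := gen_eqMixin otree.
HB.instance Definition _ := gen_choiceMixin otree.

Notation oforest := (seq otree).

Definition bullet : otree := Bplus [::].

Fixpoint tsize (t : otree) : nat :=
  let: Bplus w := t in (sumn (map tsize w)).+1.

Definition fsize (w : oforest) : nat := sumn (map tsize w).

(** * The spaces N and N^*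

    An element of N^* is its coefficient function; N is the subspace of the
    finitely supported ones.  All sums written [\sum_(i \in A) F i] below range
    over the i in A with F i != 0; by the grading there are finitely many of
    them. *)

Definition single (R : realType) (w : oforest) : oforest -> R :=
  fun w' => (w' == w)%:R.

Definition fin_supp (R : realType) (a : oforest -> R) : Prop :=
  finite_set [set w | a w != 0].

Definition conc (R : realType) (a b : oforest -> R) : oforest -> R := fun w =>
  \sum_(p \in [set p : oforest * oforest | p.1 ++ p.2 = w]) a p.1 * b p.2.

Definition bilin_ext (R : realType) (gr : oforest -> oforest -> oforest -> R)
    (a b : oforest -> R) : oforest -> R := fun w =>
  \sum_(p \in [set: oforest * oforest]) a p.1 * b p.2 * gr p.1 p.2 w.

Record is_grafting (R : realType) (gr : oforest -> oforest -> oforest -> R) :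
    Prop := IsGrafting {
  grafting_fin : forall w1 w2, fin_supp (gr w1 w2);
  grafting_nil : forall w, gr [::] w = single R w;
  grafting_tree_nil : forall t, gr [:: t] [::] = 0;
  grafting_bullet : forall w, gr w [:: bullet] = single R [:: Bplus w];
  grafting_tree_cat : forall t w1 w2,
    gr [:: t] (w1 ++ w2) = conc (gr [:: t] w1) (single R w2)
                           + conc (single R w1) (gr [:: t] w2);
  grafting_cons : forall t w w1,
    gr (t :: w) w1 = bilin_ext gr (single R [:: t]) (gr w w1)
                     - bilin_ext gr (gr [:: t] w) (single R w1) }.

(* Grafting of a word t_1...t_k on a forest: each t_i is attached, leftmost, to
   some vertex, in all possible ways, keeping the order of the t_i attached to
   the same vertex.  This witnesses that the rules above are consistent. *)
Module GraftingExistence.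

Fixpoint unsh (w : oforest) : seq (oforest * oforest) :=
  if w is t :: w' then
    [seq (t :: p.1, p.2) | p <- unsh w'] ++ [seq (p.1, t :: p.2) | p <- unsh w']
  else [:: ([::], [::])].

Definition gstep (gt : otree -> oforest -> seq otree) s (acc : oforest -> seq oforest)
   w := flatten [seq flatten [seq [seq x :: y | y <- acc p.2] | x <- gt s p.1]
     | p <- unsh w].
Definition gnil (w : oforest) : seq oforest := if w is [::] then [:: [::]] else [::].

Fixpoint gt (t : otree) (w : oforest) : seq otree :=
  let: Bplus v := t in
  flatten [seq [seq Bplus (p.1 ++ y) | y <- 
   foldr (fun s acc w => flatten [seq flatten [seq [seq x :: y | y <- acc p.2] | x <- gt s p.1]
     | p <- unsh w]) gnil v p.2] | p <- unsh w].
Definition gf v := foldr (gstep gt) gnil v.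

Lemma otree_ind' (P : otree -> Prop) (Q : oforest -> Prop) :
  (forall v, Q v -> P (Bplus v)) -> Q [::] -> (forall s v, P s -> Q v -> Q (s :: v)) ->
  (forall t, P t) /\ (forall v, Q v).
Proof.
move=> HB H0 HS.
have HP : forall t, P t.
  fix IH 1 => -[v]; apply: HB.
  by elim: v => [//|s v Hv]; apply: HS => //; apply: IH.
by split=> //; elim=> // s v; apply: HS.
Qed.

Section Existence.
Context (R : realType).
Implicit Types (w v : oforest) (t s : otree).

Definition SF v w (f : oforest -> R) := \sum_(x <- gf v w) f x.
Definition ST t w (f : otree -> R) := \sum_(x <- gt t w) f x.
Definition SU w (F : oforest -> oforest -> R) := \sum_(p <- unsh w) F p.1 p.2.

Lemma SU0 F : SU [::] F = F [::] [::].
Proof. by rewrite /SU /= big_seq1. Qed.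
Lemma SUS t w F : SU (t :: w) F = SU w (fun a b => F (t :: a) b + F a (t :: b)).
Proof. by rewrite /SU /= big_cat !big_map /= big_split. Qed.
Lemma SUD w F G : SU w (fun a b => F a b + G a b) = SU w F + SU w G.
Proof. by rewrite /SU big_split. Qed.
Lemma SUE w F G : (forall a b, F a b = G a b) -> SU w F = SU w G.
Proof. by move=> H; apply: eq_bigr. Qed.
Lemma SF0 w f : SF [::] w f = if w is [::] then f [::] else 0.
Proof. by case: w => [|t w]; rewrite /SF /= ?big_seq1 ?big_nil. Qed.
Lemma SFS s v w f : SF (s :: v) w f =
  SU w (fun a b => ST s a (fun x => SF v b (fun y => f (x :: y)))).
Proof.
rewrite /SF /= /gstep big_flatten big_map; apply: eq_bigr => p _.
rewrite big_flatten big_map; apply: eq_bigr => x _; by rewrite big_map.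
Qed.
Lemma STE v w f : ST (Bplus v) w f = SU w (fun a b => SF v b (fun y => f (Bplus (a ++ y)))).
Proof.
rewrite /ST /= big_flatten big_map; apply: eq_bigr => p _; by rewrite big_map.
Qed.
Lemma SFD v w f g : SF v w (fun x => f x + g x) = SF v w f + SF v w g.
Proof. by rewrite /SF big_split. Qed.
Lemma STD t w f g : ST t w (fun x => f x + g x) = ST t w f + ST t w g.
Proof. by rewrite /ST big_split. Qed.
Lemma SFE v w f g : f =1 g -> SF v w f = SF v w g.
Proof. by move=> H; apply: eq_bigr. Qed.
Lemma STEE t w f g : f =1 g -> ST t w f = ST t w g.
Proof. by move=> H; apply: eq_bigr. Qed.
Lemma SF_ST v w t w' f : SF v w (fun x => ST t w' (f x)) = ST t w' (fun y => SF v w (f^~ y)).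
Proof. by rewrite /SF /ST exchange_big. Qed.
Lemma SF_SF v w v' w' f : SF v w (fun x => SF v' w' (f x)) = SF v' w' (fun y => SF v w (f^~ y)).
Proof. by rewrite /SF exchange_big. Qed.
Lemma SF_SU v w w' f : SF v w (fun x => SU w' (f x)) = SU w' (fun a b => SF v w (fun x => f x a b)).
Proof. by rewrite /SF /SU exchange_big. Qed.

Lemma gf_nil v f : SF v [::] f = f v.
Proof.
move: v f; suff [] : (forall t f, ST t [::] f = f t) /\ (forall v f, SF v [::] f = f v) by [].
apply: otree_ind'.
- by move=> v H f; rewrite STE SU0 H.
- by move=> f; rewrite SF0.
- by move=> s v Hs Hv f; rewrite SFS SU0 Hs Hv.
Qed.
Lemma gt_nil t f : ST t [::] f = f t.
Proof. by case: t => v; rewrite STE SU0 gf_nil. Qed.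

Lemma SFS1 s v t f : SF (s :: v) [:: t] f =
  ST s [:: t] (fun x => f (x :: v)) + SF v [:: t] (fun y => f (s :: y)).
Proof.
by rewrite SFS SUS SU0 gt_nil; congr (_ + _); apply: STEE => x; rewrite gf_nil.
Qed.
Lemma ST1 v t f : ST (Bplus v) [:: t] f =
   f (Bplus (t :: v)) + SF v [:: t] (fun y => f (Bplus y)).
Proof. by rewrite STE SUS SU0 gf_nil. Qed.

Lemma SFcat1 a b t f : SF (a ++ b) [:: t] f =
  SF a [:: t] (fun x => f (x ++ b)) + SF b [:: t] (fun y => f (a ++ y)).
Proof.
elim: a f => [|s a IH] f /=; first by rewrite SF0 add0r.
by rewrite !SFS1 IH addrA.
Qed.

Lemma coprod w t F : SF w [:: t] (fun x => SU x F) =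
  SU w (fun a b => SF a [:: t] (F^~ b) + SF b [:: t] (F a)).
Proof.
elim: w F => [|s w IH] F; first by rewrite !SF0 SU0 !SF0 addr0.
rewrite SFS1 SUS.
under STEE do rewrite SUS.
under SFE do rewrite SUS.
rewrite IH.
have -> : forall F, ST s [:: t] (fun x => SU w (F x)) = SU w (fun a b => ST s [:: t] (fun x => F x a b)).
  by move=> G; rewrite /ST /SU exchange_big.
rewrite -SUD; apply: SUE => a b.
rewrite STD !SFD !SFS1. ring.
Qed.

Lemma key t v w f : SF v w (fun x => SF x [:: t] f) =
  SF v (t :: w) f + SF w [:: t] (fun x => SF v x f).
Proof.
move: v w f; suff [] : (forall s w f, ST s w (fun x => ST x [:: t] f) =
  ST s (t :: w) f + SF w [:: t] (fun x => ST s x f)) /\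
  (forall v w f, SF v w (fun x => SF x [:: t] f) =
  SF v (t :: w) f + SF w [:: t] (fun x => SF v x f)) by [].
apply: otree_ind'.
- move=> v IH w f; rewrite !STE SUS.
  under SUE => a b do under SFE do rewrite ST1 SFcat1.
  under [X in _ + X]SFE do rewrite STE.
  rewrite coprod -SUD; apply: SUE => a b.
  rewrite !SFD (IH b (fun y => f (Bplus (a ++ y)))) (SF_SF v b a) /=. ring.
- move=> w f; rewrite !SF0.
  case: w => [|s w]; first by rewrite !SF0 addr0.
  rewrite SFS1 add0r.
  under STEE do rewrite SF0. under SFE do rewrite SF0.
  by rewrite /ST /SF !big1_eq addr0.
- move=> s v Hs Hv w f; rewrite !SFS SUS.
  under SUE => a b do under STEE => x do under SFE do rewrite SFS1.
  under [X in _ + X]SFE do rewrite SFS.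
  rewrite coprod -SUD; apply: SUE => a b.
  under STEE => x do rewrite SFD (Hv b (fun y => f (x :: y))).
  rewrite !STD.
  have -> : ST s a (fun x => SF v b (fun y => ST x [:: t] (fun x' => f (x' :: y))))
    = ST s a (fun x => ST x [:: t] (fun x' => SF v b (fun y => f (x' :: y)))).
    by apply: STEE => x; rewrite SF_ST.
  rewrite (Hs a (fun x' => SF v b (fun y => f (x' :: y)))).
  rewrite -(SF_ST b [:: t] s a (fun x0 x => SF v x0 (fun y => f (x :: y)))). ring.
Qed.

Definition lsum (J : choiceType) (l : seq J) : J -> R := fun z => \sum_(x <- l) (z == x)%:R.

Lemma fsbig_lsum (J : choiceType) (l : seq J) (D : set J) (K : J -> R) :
  \sum_(p \in D) lsum l p * K p = \sum_(x <- l | x \in D) K x.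
Proof.
rewrite fsbig_mkcond (fsbigTE [fset x in l]%fset); last first.
  move=> p; rewrite inE => pl; rewrite /patch; case: ifP => // _.
  rewrite /lsum big_seq big1 ?mul0r // => x xl.
  by case: eqP => // e; move: pl; rewrite e /= xl.
rewrite [RHS]big_mkcond /=.
under eq_bigr => p _ do rewrite /patch.
transitivity (\sum_(p <- [fset x in l]%fset) \sum_(x <- l) (p == x)%:R * (if p \in D then K p else 0)).
  by apply: eq_bigr => p _; rewrite -mulr_suml; case: ifP; rewrite ?mulr0.
rewrite exchange_big /= big_seq [RHS]big_seq; apply: eq_bigr => x xl.
rewrite (bigD1_seq x) ?fset_uniq ?inE //= eqxx mul1r big1 ?addr0 // => p /negbTE ->.
by rewrite mul0r.
Qed.

Lemma lsum_prod (l m : seq oforest) p : lsum l p.1 * lsum m p.2 =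
  lsum [seq (x, y) | x <- l, y <- m] p.
Proof.
rewrite /lsum big_allpairs_dep /= mulr_suml; apply: eq_bigr => x _.
rewrite mulr_sumr; apply: eq_bigr => y _.
by rewrite -natrM mulnb; case: p.
Qed.

Lemma lsum1 w : lsum [:: w] = single R w.
Proof. by apply/funext => z; rewrite /lsum big_seq1. Qed.

Lemma conc_lsum l m z : conc (lsum l) (lsum m) z =
  \sum_(x <- l) \sum_(y <- m) (z == x ++ y)%:R :> R.
Proof.
rewrite /conc; under eq_fsbigr do rewrite lsum_prod -[lsum _ _]mulr1.
rewrite fsbig_lsum big_mkcond big_allpairs_dep /=.
apply: eq_bigr => x _; apply: eq_bigr => y _ /=.
case: ifPn => [/set_mem /= <-|nz]; first by rewrite eqxx.
by case: eqP => // e; case/negP: nz; apply: mem_set; rewrite e.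
Qed.

Definition gr0 w v : oforest -> R := lsum (gf v w).

Lemma gr0E w v z : gr0 w v z = SF v w (fun x => (z == x)%:R).
Proof. by []. Qed.

Lemma bilin_lsum l m z : bilin_ext gr0 (lsum l) (lsum m) z =
  \sum_(x <- l) \sum_(y <- m) gr0 x y z.
Proof.
rewrite /bilin_ext; under eq_fsbigr do rewrite lsum_prod.
rewrite fsbig_lsum big_mkcond big_allpairs_dep /=.
by apply: eq_bigr => x _; apply: eq_bigr => y _ /=; rewrite in_setT.
Qed.

Lemma SUnil w (f : oforest -> R) : SU w (fun a b => if b is [::] then f a else 0) = f w.
Proof.
elim: w f => [|t w IH] f; first by rewrite SU0.
rewrite SUS -(IH (fun a => f (t :: a))); apply: SUE => a b; by rewrite addr0.
Qed.

Lemma grafting_exists : exists gr, @is_grafting R gr.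
Proof.
exists gr0; split.
- move=> w v; apply: (sub_finite_set _ (finite_seq (gf v w))) => z /= zn.
  apply: contraNT zn => zn; rewrite /gr0 /lsum big_seq big1 // => x xl.
  by case: eqP => // e; move: zn; rewrite e xl.
- by move=> w; apply/funext => z; rewrite gr0E gf_nil.
- by move=> t; apply/funext => z; rewrite gr0E SF0.
- move=> w; apply/funext => z; rewrite gr0E SFS.
  transitivity (SU w (fun a b => if b is [::] then single R [:: Bplus a] z else 0)).
    apply: SUE => a b; rewrite STE.
    transitivity (SU a (fun a' b' => if b' is [::] then (if b is [::] then single R [:: Bplus a'] z else 0) else 0)).
      apply: SUE => a' b'; rewrite !SF0; by case: b' => //; case: b => //=; rewrite cats0.
    by rewrite SUnil; case: b.
  by rewrite SUnil.
- move=> t w1 w2; apply/funext => z; rewrite gr0E SFcat1.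
  rewrite /GRing.add /= -!lsum1 !conc_lsum big_seq1.
  by congr (_ + _); apply: eq_bigr => x _; rewrite big_seq1.
- move=> t w w1; apply/funext => z.
  rewrite /GRing.add /= /GRing.opp /= -!lsum1 !bilin_lsum big_seq1.
  rewrite gr0E; apply/eqP; rewrite eq_sym subr_eq; apply/eqP.
  under [in RHS]eq_bigr do rewrite big_seq1.
  exact: key.
Qed.
End Existence.

End GraftingExistence.

Definition grafting_basis (R : realType) : oforest -> oforest -> oforest -> R :=
  xget (fun _ _ => 0) [set gr | is_grafting gr].

Lemma grafting_basisP (R : realType) : is_grafting (@grafting_basis R).
Proof.
have [gr grP] := GraftingExistence.grafting_exists R.
exact: (xgetPex _ (ex_intro _ gr grP)).
Qed.

Definition graft (R : realType) : (oforest -> R) -> (oforest -> R) -> oforest -> R :=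
  bilin_ext (grafting_basis R).

(** * Lie polynomials and Lie series *)

Inductive lie_polynomial (R : realType) : (oforest -> R) -> Prop :=
| Lie_tree t : lie_polynomial (single R [:: t])
| Lie_zero : lie_polynomial 0
| Lie_lin (c : R) a b :
    lie_polynomial a -> lie_polynomial b -> lie_polynomial (c *: a + b)
| Lie_bracket a b :
    lie_polynomial a -> lie_polynomial b -> lie_polynomial (conc a b - conc b a).

Definition homog (R : realType) (n : nat) (a : oforest -> R) : oforest -> R :=
  fun w => if fsize w == n then a w else 0.

Definition lie_series (R : realType) (a : oforest -> R) : Prop :=
  forall n, lie_polynomial (homog n a).

(** * Substitution *)

Fixpoint subst_tree (R : realType) (beta : oforest -> R) (t : otree) :
    oforest -> R :=
  let: Bplus w := t in
  graft (foldr (fun s acc => conc (subst_tree beta s) acc) (single R [::]) w) beta.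

Definition subst_forest (R : realType) (beta : oforest -> R) (w : oforest) :
    oforest -> R :=
  foldr (fun s acc => conc (subst_tree beta s) acc) (single R [::]) w.

Definition subst (R : realType) (beta alpha : oforest -> R) : oforest -> R :=
  fun w' => \sum_(w \in [set: oforest]) alpha w * subst_forest beta w w'.

(** * Smooth manifolds *)

(* C^k on an open set A; [Ck_on] is only used for open A, and only depends on
   the restriction of f to A. *)
Fixpoint Ck_on (R : realType) (V W : normedModType R) (k : nat) (A : set V)
    (f : V -> W) : Prop :=
  match k with
  | 0 => forall x, A x -> {for x, continuous f}
  | k'.+1 => (forall x, A x -> differentiable f x) /\
             forall v : V, Ck_on k' A (fun x => 'd f x v)
  end.

Definition smooth_on (R : realType) (V W : normedModType R) (A : set V)
    (f : V -> W) : Prop :=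
  forall k, Ck_on k A f.

(* [ccoord] and [cpoint] are mutually inverse homeomorphisms between the open
   sets [cdom] and [ccoord @` cdom]; their values elsewhere are irrelevant. *)
Record chart (R : realType) (n : nat) (M : topologicalType) := Chart {
  cdom : set M;
  ccoord : M -> 'rV[R]_n;
  cpoint : 'rV[R]_n -> M;
  chart_open_dom : open cdom;
  chart_open_img : open (ccoord @` cdom);
  chart_continuous : forall p, cdom p -> {for p, continuous ccoord};
  chart_continuousV :
    forall x, (ccoord @` cdom) x -> {for x, continuous cpoint};
  chartK : forall p, cdom p -> cpoint (ccoord p) = p }.

Definition smooth_manifold (R : realType) (n : nat) (M : topologicalType)
    (atlas : set (chart R n M)) : Prop :=
  [/\ hausdorff_space M,
      @second_countable M,
      forall p, exists2 c, atlas c & cdom c p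
    & forall c d, atlas c -> atlas d ->
        smooth_on (ccoord c @` (cdom c `&` cdom d)) (ccoord d \o cpoint c)].

Definition smooth_fun (R : realType) (n : nat) (M : topologicalType)
    (atlas : set (chart R n M)) (phi : M -> R) : Prop :=
  forall c, atlas c -> smooth_on (ccoord c @` cdom c) (phi \o cpoint c).

(** * Vector fields *)

(* A vector field is represented by its action on C^oo(M); to make Leibniz
   equality the right one, it is set to 0 on functions that are not smooth. *)
Definition vfield (R : realType) (M : topologicalType) : Type :=
  (M -> R) -> (M -> R).

HB.instance Definition _ (R : realType) (M : topologicalType) :=
  GRing.Lmodule.copy (vfield R M) ((M -> R) -> (M -> R)).

(* X = \sum_i b_i d/dx_i in each chart, with b smooth *)
Definition is_vfield (R : realType) (n : nat) (M : topologicalType)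
    (atlas : set (chart R n M)) (X : vfield R M) : Prop :=
  (forall phi, ~ smooth_fun atlas phi -> X phi = 0) /\
  forall c, atlas c ->
    exists2 b : 'rV[R]_n -> 'rV[R]_n,
      smooth_on (ccoord c @` cdom c) b
    & forall phi p, smooth_fun atlas phi -> cdom c p ->
        X phi p = 'd (phi \o cpoint c) (ccoord c p) (b (ccoord c p)).

Definition vbracket (R : realType) (M : topologicalType) (X Y : vfield R M) :
    vfield R M :=
  fun phi => X (Y phi) - Y (X phi).

Definition lie_subalgebra (R : realType) (n : nat) (M : topologicalType)
    (atlas : set (chart R n M)) (g : set (vfield R M)) : Prop :=
  [/\ forall X, g X -> is_vfield atlas X,
      g 0,
      forall (a : R) X Y, g X -> g Y -> g (a *: X + Y)
    & forall X Y, g X -> g Y -> g (vbracket X Y)].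

Definition integral_curve (R : realType) (n : nat) (M : topologicalType)
    (atlas : set (chart R n M)) (X : vfield R M) (p : M) (gamma : R -> M) : Prop :=
  gamma 0 = p /\
  \forall t \near (0 : R), {for t, continuous gamma} /\
    forall phi, smooth_fun atlas phi ->
      is_derive t (1 : R) (phi \o gamma) (X phi (gamma t)).

(* exp(tX)(p); X need not be complete, so this is only meaningful for t near 0 *)
Definition flow (R : realType) (n : nat) (M : topologicalType)
    (atlas : set (chart R n M)) (X : vfield R M) (p : M) : R -> M :=
  xget (fun=> p) [set gamma | integral_curve atlas X p gamma].

(** * The universal enveloping algebra *)

(* linear maps g -> A taking the Lie bracket to the commutator; the values
   outside g are irrelevant *)
Definition lie_morphism (R : realType) (M : topologicalType)
    (g : set (vfield R M)) (A : algType R) (phi : vfield R M -> A) : Prop :=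
  (forall (a : R) X Y, g X -> g Y -> phi (a *: X + Y) = a *: phi X + phi Y) /\
  (forall X Y, g X -> g Y -> phi (vbracket X Y) = phi X * phi Y - phi Y * phi X).

Definition enveloping_algebra (R : realType) (M : topologicalType)
    (g : set (vfield R M)) (U : algType R) (iota : vfield R M -> U) : Prop :=
  lie_morphism g iota /\
  forall (A : algType R) (phi : vfield R M -> A), lie_morphism g phi ->
    (exists h : {lrmorphism U -> A}, forall X, g X -> h (iota X) = phi X) /\
    (forall h1 h2 : {lrmorphism U -> A},
       (forall X, g X -> h1 (iota X) = h2 (iota X)) -> h1 =1 h2).

(** * Smooth maps into g and U(g), and the Lie derivative *)

(* C^oo(M, S) for a linear subspace S of a possibly infinite-dimensional E:
   locally the map takes its values in a finite-dimensional subspace of S and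
   is smooth there.  Taking the c_i smooth on all of M rather than near p makes
   no difference, thanks to bump functions. *)
Definition smooth_map (R : realType) (n : nat) (M : topologicalType)
    (atlas : set (chart R n M)) (E : lmodType R) (S : set E) (Psi : M -> E) :
    Prop :=
  forall p : M, exists m (c : 'I_m -> M -> R) (u : 'I_m -> E),
    [/\ forall i, smooth_fun atlas (c i),
        forall i, S (u i)
      & \forall q \near p, Psi q = \sum_(i < m) c i q *: u i].

(* derivative at 0 of a curve staying, near 0, in a finite-dimensional subspace *)
Definition curve_derivative (R : realType) (E : lmodType R) (c : R -> E) (v : E) :
    Prop :=
  exists m (a : 'I_m -> R -> R) (u : 'I_m -> E),
    [/\ forall i, derivable (a i) 0 1,
        \forall t \near (0 : R), c t = \sum_(i < m) a i t *: u i
      & v = \sum_(i < m) 'D_1 (a i) 0 *: u i].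

(* V[Psi](p) = d/dt|_{t=0} Psi(exp(tV)(p)) *)
Definition lie_deriv (R : realType) (n : nat) (M : topologicalType)
    (atlas : set (chart R n M)) (E : lmodType R) (V : vfield R M)
    (Psi : M -> E) : M -> E :=
  fun p => xget 0 [set v | curve_derivative (Psi \o flow atlas V p) v].

Record is_action (R : realType) (n : nat) (M : topologicalType)
    (atlas : set (chart R n M)) (g : set (vfield R M)) (U : algType R)
    (iota : vfield R M -> U) (rho : U -> (M -> U) -> (M -> U)) : Prop := IsAction {
  action_lin : forall (a : R) u v Psi, smooth_map atlas setT Psi ->
    rho (a *: u + v) Psi = a *: rho u Psi + rho v Psi;
  action_one : forall Psi, smooth_map atlas setT Psi -> rho 1 Psi = Psi;
  action_mul : forall u v Psi, smooth_map atlas setT Psi ->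
    rho (u * v) Psi = rho u (rho v Psi);
  action_vfield : forall V Psi, g V -> smooth_map atlas setT Psi ->
    rho (iota V) Psi = lie_deriv atlas V Psi }.

(* u[Psi] for u in U(g); determined for smooth Psi, the only ones it is
   applied to *)
Definition uact (R : realType) (n : nat) (M : topologicalType)
    (atlas : set (chart R n M)) (g : set (vfield R M)) (U : algType R)
    (iota : vfield R M -> U) : U -> (M -> U) -> (M -> U) :=
  xget (fun _ _ => 0) [set rho | is_action atlas g iota rho].

(* G[K](p) = (G(p)[K])(p) *)
Definition mact (R : realType) (n : nat) (M : topologicalType)
    (atlas : set (chart R n M)) (g : set (vfield R M)) (U : algType R)
    (iota : vfield R M -> U) (G K : M -> U) : M -> U :=
  fun p => uact atlas g iota (G p) K p.

Definition mmul (R : realType) (M : topologicalType) (U : algType R)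
    (G K : M -> U) : M -> U :=
  fun p => G p * K p.

(** * Elementary differentials and Lie--Butcher series *)

Fixpoint eldiff_tree (R : realType) (n : nat) (M : topologicalType)
    (atlas : set (chart R n M)) (g : set (vfield R M)) (U : algType R)
    (iota : vfield R M -> U) (f : M -> vfield R M) (t : otree) : M -> U :=
  let: Bplus w := t in
  mact atlas g iota
    (foldr (fun s acc => mmul (eldiff_tree atlas g iota f s) acc) (fun=> 1) w)
    (iota \o f).

Definition eldiff (R : realType) (n : nat) (M : topologicalType)
    (atlas : set (chart R n M)) (g : set (vfield R M)) (U : algType R)
    (iota : vfield R M -> U) (f : M -> vfield R M) (w : oforest) : M -> U :=
  foldr (fun s acc => mmul (eldiff_tree atlas g iota f s) acc) (fun=> 1) w.

(* Elements of U(g)^M[[h]] are their sequences of coefficients. *)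

(* B_f(alpha) = \sum_w h^|w| alpha(w) F_f(w) *)
Definition LB (R : realType) (n : nat) (M : topologicalType)
    (atlas : set (chart R n M)) (g : set (vfield R M)) (U : algType R)
    (iota : vfield R M -> U) (f : M -> vfield R M) (alpha : oforest -> R) :
    nat -> M -> U :=
  fun k => \sum_(w \in [set w | fsize w = k]) alpha w *: eldiff atlas g iota f w.

Definition hone (R : realType) (M : topologicalType) (U : algType R) :
    nat -> M -> U :=
  fun k _ => (k == 0%N)%:R.

Definition hmul (R : realType) (M : topologicalType) (U : algType R)
    (G K : nat -> M -> U) : nat -> M -> U :=
  fun k => \sum_(i < k.+1) mmul (G i) (K (k - i)%N).

Definition hact (R : realType) (n : nat) (M : topologicalType)
    (atlas : set (chart R n M)) (g : set (vfield R M)) (U : algType R)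
    (iota : vfield R M -> U) (G K : nat -> M -> U) : nat -> M -> U :=
  fun k => \sum_(i < k.+1) mact atlas g iota (G i) (K (k - i)%N).

Fixpoint heldiff_tree (R : realType) (n : nat) (M : topologicalType)
    (atlas : set (chart R n M)) (g : set (vfield R M)) (U : algType R)
    (iota : vfield R M -> U) (ft : nat -> M -> U) (t : otree) : nat -> M -> U :=
  let: Bplus w := t in
  hact atlas g iota
    (foldr (fun s acc => hmul (heldiff_tree atlas g iota ft s) acc)
           (@hone R M U) w)
    ft.

Definition heldiff (R : realType) (n : nat) (M : topologicalType)
    (atlas : set (chart R n M)) (g : set (vfield R M)) (U : algType R)
    (iota : vfield R M -> U) (ft : nat -> M -> U) (w : oforest) : nat -> M -> U :=
  foldr (fun s acc => hmul (heldiff_tree atlas g iota ft s) acc) (@hone R M U) w.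

(* B_ft(alpha) = \sum_w alpha(w) F_ft(w); when ft is in h U(g)^M[[h]], F_ft(w)
   is divisible by h^|w|, so each coefficient is a finite sum. *)
Definition hLB (R : realType) (n : nat) (M : topologicalType)
    (atlas : set (chart R n M)) (g : set (vfield R M)) (U : algType R)
    (iota : vfield R M -> U) (ft : nat -> M -> U) (alpha : oforest -> R) :
    nat -> M -> U :=
  fun k => \sum_(w \in [set: oforest]) alpha w *: heldiff atlas g iota ft w k.

(* Main.v *)
Require Import Defs.
From HB Require Import structures.
From mathcomp Require Import all_boot all_order all_algebra.
From mathcomp Require Import all_classical all_reals all_analysis.
From mathcomp Require Import finmap ring lra.
(* So that [tsize] is the size of a tree, not of a tuple. *)
Import Defs.

(** Both sides of the identity are sums over forests built by the same three
    rules (empty word, concatenation, adding a root), so it suffices that the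
    map a |-> LB a turns each rule on series into the matching rule on formal
    vector fields: the unit into the unit, [conc] into [hmul], and [graft] into
    [hact].  Granting this, induction on trees gives
    F_ft(w) = LB (subst_forest beta w) for ft = LB beta ([heldiff_subst]), and
    summing against alpha, degree by degree, is the theorem
    ([LB_substitution]).  A Lie series has no constant term, which makes all
    these sums finite in each degree.

    By bilinearity the rules for series reduce to words, and the one with
    content is F(x grafted on y) = F(x)[F(y)].  The grafting product is
    determined by a recursion which uses exactly the axioms of a D-algebra: a
    unital associative algebra with an action [op] of it on itself, and a
    distinguished set L of elements that act as derivations and satisfy
    d[x[y]] = (d x)[y] + (d[x])[y].  Hence any map on words that is
    multiplicative and sends B+(w) to F(w)[f], with f in L, transports
    grafting to the action ([eval_deg_grafting], by the induction principle
    [grafting_ind], which follows the recursion).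

    It remains to see that differential operators form a D-algebra.  The algebra
    consists of the maps M -> U(g) that are locally finite combinations, with
    smooth coefficients, of products iota(V_1)...iota(V_k); L consists of the
    locally finite combinations of the iota(V).  The two derivation axioms are
    the product rule for V[.] along the flow of V ([lie_deriv_mul],
    [lie_deriv_sumZ]).  Closure under the action needs V[Psi] to be smooth
    again.  Near p, with Psi = sum c_i u_i, it is sum V(c_i) u_i: the flow through
    each point must therefore really be an integral curve, which is the
    Picard--Lindelof theorem ([picard_lindelof]), and the derivative of a curve
    in U(g) must not depend on how it is written with scalar coefficients, which
    is elimination of linear relations ([curve_derivative_unique]).

    All this concerns a genuine action of U(g).  By definition [uact] is zero if
    there is none; then F(w) = 0 for every nonempty w, the identity
    F(x grafted on y) = F(x)[F(y)] persists for nonempty y because grafting keeps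
    the length of y, and the same induction applies. *)

Set Implicit Arguments.
Unset Strict Implicit.
Unset Printing Implicit Defensive.

Import Order.TTheory GRing.Theory Num.Theory.
Import numFieldNormedType.Exports.

Local Open Scope classical_set_scope.
Local Open Scope ring_scope.

(** * Formal sums over ordered forests *)

Section Forests.
Implicit Types (t : otree) (v w : oforest).

Lemma fsize_cat v w : fsize (v ++ w) = (fsize v + fsize w)%N.
Proof. by rewrite /fsize map_cat sumn_cat. Qed.

Lemma fsize_cons t w : fsize (t :: w) = (tsize t + fsize w)%N.
Proof. by []. Qed.

Lemma fsize_tree v : fsize [:: Bplus v] = (fsize v).+1.
Proof. by rewrite /fsize /= addn0. Qed.

Lemma fsize_eq0 w : (fsize w == 0)%N = (w == [::]).
Proof. by case: w => [|[v] w]//; rewrite eqxx. Qed.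

(** Peeling off the root of the first tree writes a nonempty forest of size
    at most k + 1 as [Bplus v :: w] with v and w of size at most k. *)
Lemma finite_forests_le k : finite_set [set w | (fsize w <= k)%N].
Proof.
suff [l lP] : exists l : seq oforest, forall w, (fsize w <= k)%N -> w \in l.
  exact: sub_finite_set lP (finite_seq l).
elim: k => [|k [l lP]].
  by exists [:: [::]] => w; rewrite leqn0 fsize_eq0 inE.
exists ([::] :: [seq Bplus v :: w | v <- l, w <- l]) => -[|[v] w] //= wk.
rewrite inE; apply/orP; right; apply/allpairsP; exists (v, w) => /=.
move: wk; rewrite fsize_cons /= ltnS => wk.
by split=> //; apply: lP; apply: leq_trans wk; rewrite /fsize ?leq_addr ?leq_addl.
Qed.

Lemma finite_forests k : finite_set [set w | fsize w = k].
Proof. by apply: sub_finite_set (finite_forests_le k) => w /= ->. Qed.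

Definition forests k : seq oforest := fset_set [set w | fsize w = k].

Lemma forests_uniq k : uniq (forests k).
Proof. exact: fset_uniq. Qed.

Lemma mem_forests k w : (w \in forests k) = (fsize w == k).
Proof.
rewrite /forests in_fset_set; last exact: finite_forests.
by apply/idP/eqP; [move/set_mem|move=> wk; exact: mem_set].
Qed.

Lemma big_forests_le (E : nmodType) k (G : oforest -> E) :
  \sum_(w \in [set w | (fsize w <= k)%N]) G w =
  \sum_(i < k.+1) \sum_(w <- forests i) G w.
Proof.
rewrite fsbig_finite; last exact: finite_forests_le.
have mem w : (w \in fset_set [set w | (fsize w <= k)%N]) = (fsize w <= k)%N.
  rewrite in_fset_set; last exact: finite_forests_le.
  by apply/idP/idP; [move/set_mem|move=> wk; exact: mem_set].
rewrite big_seq (partition_big (fun w => inord (fsize w) : 'I_k.+1) xpredT)//=.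
apply: eq_bigr => i _; rewrite -big_filter; apply: perm_big; apply: uniq_perm.
- by rewrite filter_uniq// fset_uniq.
- exact: forests_uniq.
- move=> w; rewrite mem_filter mem_forests mem; apply/idP/eqP => [|wi].
    by move=> /andP[/andP[wk /eqP <-] _]; rewrite inordK.
  by rewrite wi -ltnS ltn_ord andbT; apply/eqP/val_inj; rewrite /= inordK.
Qed.

End Forests.

(** * Homogeneous parts of series *)

Section Gradings.
Context {R : realType}.
Implicit Types (t : otree) (v w x y z : oforest) (a b : oforest -> R).

(** The degree k part of the formal sum of the a(w) F(w).  Finiteness comes from
    the grading alone, so a may be any series and linearity in a holds without
    side condition. *)
Definition eval_deg (E : lmodType R) (F : oforest -> E) k a : E :=
  \sum_(w <- forests k) a w *: F w.

Definition graded_product (m : oforest -> oforest -> oforest -> R) :=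
  forall x y w, m x y w != 0 -> fsize w = (fsize x + fsize y)%N.

Lemma fsbig_forests (E : lmodType R) (F : oforest -> E) k a :
  \sum_(w \in [set w | fsize w = k]) a w *: F w = eval_deg F k a.
Proof. by rewrite fsbig_finite//; exact: finite_forests. Qed.

Lemma eval_deg_single (E : lmodType R) (F : oforest -> E) w k :
  eval_deg F k (single R w) = if fsize w == k then F w else 0.
Proof.
rewrite /eval_deg; case: ifPn => [wk|wk].
  rewrite (bigD1_seq w) ?forests_uniq ?mem_forests//= /single eqxx scale1r.
  by rewrite big1 ?addr0// => x /negbTE ->; rewrite scale0r.
rewrite big_seq big1// => x; rewrite mem_forests /single => /eqP xk.
by case: eqP => [xw|_]; [rewrite -xw xk eqxx in wk|rewrite scale0r].
Qed.

Lemma eval_degD (E : lmodType R) (F : oforest -> E) k a b :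
  eval_deg F k (a + b) = eval_deg F k a + eval_deg F k b.
Proof. by rewrite /eval_deg -big_split; apply: eq_bigr => w _; rewrite scalerDl. Qed.

Lemma eval_degB (E : lmodType R) (F : oforest -> E) k a b :
  eval_deg F k (a - b) = eval_deg F k a - eval_deg F k b.
Proof. by rewrite /eval_deg -sumrB; apply: eq_bigr => w _; rewrite -scalerBl. Qed.

(** For a graded product the a priori infinite sum defining [bilin_ext]
    only involves pairs of words whose sizes add up to that of w. *)
Lemma bilin_extE m a b w k : graded_product m -> fsize w = k ->
  bilin_ext m a b w =
  \sum_(i < k.+1) \sum_(x <- forests i) \sum_(y <- forests (k - i))
    a x * b y * m x y w.
Proof.
move=> mg wk; pose D := [set w | (fsize w <= k)%N].
have Dfin : finite_set D by exact: finite_forests_le.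
pose G x y := a x * b y * m x y w.
rewrite /bilin_ext -(@fsbig_widen _ _ _ _ (D `*` D))//; last first.
  move=> [x y] [_ /= Dxy]; have [/mg|] := boolP (m x y w != 0); last first.
    by rewrite negbK => /eqP ->; rewrite mulr0.
  by rewrite wk => kE; case: Dxy; rewrite /D /= kE leq_addr leq_addl.
rewrite -(pair_fsbig _ G)//= big_forests_le; apply: eq_bigr => i _.
apply: eq_big_seq => x; rewrite mem_forests => /eqP xi.
rewrite big_forests_le (bigD1 (inord (k - i)))//= inordK ?ltnS ?leq_subr//.
rewrite [X in _ + X]big1 ?addr0// => j ji; rewrite big_seq big1// => y.
rewrite mem_forests => /eqP yj; rewrite /G.
have [/mg|] := boolP (m x y w != 0); last by rewrite negbK => /eqP ->; rewrite mulr0.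
rewrite wk xi yj => kE; case/eqP: ji; apply: val_inj => /=.
by rewrite inordK ?ltnS ?leq_subr// -[LHS](addKn i) -kE.
Qed.

Lemma eval_deg_bilin (E : lmodType R) (F : oforest -> E) m a b k : graded_product m ->
  eval_deg F k (bilin_ext m a b) =
  \sum_(i < k.+1) \sum_(x <- forests i) \sum_(y <- forests (k - i))
    (a x * b y) *: eval_deg F k (m x y).
Proof.
move=> mg; rewrite {1}/eval_deg.
under eq_big_seq => w wk do (move: wk; rewrite mem_forests => /eqP wk;
  rewrite (bilin_extE a b mg wk) scaler_suml).
rewrite exchange_big; apply: eq_bigr => i _.
under eq_bigr do rewrite scaler_suml.
rewrite exchange_big; apply: eq_bigr => x _.
under eq_bigr do rewrite scaler_suml.
rewrite exchange_big; apply: eq_bigr => y _.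
by rewrite /eval_deg scaler_sumr; apply: eq_bigr => w _; rewrite scalerA.
Qed.

End Gradings.

(** * Graded products and bilinear operations *)

Section Bilinear.
Context {R : realType} {E : lmodType R}.
Variables (A : set E).

Definition subspace_set := A 0 /\ forall (c : R) x y, A x -> A y -> A (c *: x + y).

(** Bilinearity is only required on a subspace because the action of U(g) is
    controlled on smooth maps only. *)
Definition bilinear_on (op : E -> E -> E) :=
  (forall c x y z, A x -> A y -> A z -> op (c *: x + y) z = c *: op x z + op y z) /\
  (forall c x y z, A x -> A y -> A z -> op z (c *: x + y) = c *: op z x + op z y).

Hypothesis Asub : subspace_set.

Lemma subspace_sum (I : eqType) (s : seq I) (a : I -> R) (G : I -> E) :
  (forall i, i \in s -> A (G i)) -> A (\sum_(i <- s) a i *: G i).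
Proof.
have [A0 Alin] := Asub.
elim: s => [|i s IH] GA; first by rewrite big_nil.
rewrite big_cons; apply: Alin; first by apply: GA; rewrite mem_head.
by apply: IH => j js; apply: GA; rewrite inE js orbT.
Qed.

Variable op : E -> E -> E.
Hypothesis opbil : bilinear_on op.

Lemma bilinear0l z : A z -> op 0 z = 0.
Proof.
move=> Az; have [A0 _] := Asub; have [opl _] := opbil.
have := opl (-1) 0 0 z A0 A0 Az.
by rewrite scaler0 addr0 scaleN1r addNr.
Qed.

Lemma bilinear0r z : A z -> op z 0 = 0.
Proof.
move=> Az; have [A0 _] := Asub; have [_ opr] := opbil.
have := opr (-1) 0 0 z A0 A0 Az.
by rewrite scaler0 addr0 scaleN1r addNr.
Qed.

Lemma bilinear_suml (I : eqType) (s : seq I) (a : I -> R) (G : I -> E) z :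
  (forall i, i \in s -> A (G i)) -> A z ->
  op (\sum_(i <- s) a i *: G i) z = \sum_(i <- s) a i *: op (G i) z.
Proof.
move=> GA Az; elim: s GA => [|i s IH] GA.
  by rewrite !big_nil bilinear0l.
have GAs j : j \in s -> A (G j) by move=> js; apply: GA; rewrite inE js orbT.
rewrite !big_cons opbil.1 ?IH//; first by apply: GA; rewrite mem_head.
exact: subspace_sum.
Qed.

Lemma bilinear_sumr (I : eqType) (s : seq I) (a : I -> R) (G : I -> E) z :
  (forall i, i \in s -> A (G i)) -> A z ->
  op z (\sum_(i <- s) a i *: G i) = \sum_(i <- s) a i *: op z (G i).
Proof.
move=> GA Az; elim: s GA => [|i s IH] GA.
  by rewrite !big_nil bilinear0r.
have GAs j : j \in s -> A (G j) by move=> js; apply: GA; rewrite inE js orbT.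
rewrite !big_cons opbil.2 ?IH//; first by apply: GA; rewrite mem_head.
exact: subspace_sum.
Qed.

Variables (F : oforest -> E).
Hypothesis FA : forall w, A (F w).

Lemma eval_deg_subspace k a : A (eval_deg F k a).
Proof. exact: subspace_sum. Qed.

(** A map on words that turns a graded product m into a bilinear operation
    turns the extension of m to series into the Cauchy product of that
    operation.  The compatibility is only asked where both coefficients are
    nonzero, so that pairs excluded by the supports need not be examined. *)
Lemma eval_deg_bilin_op (m : oforest -> oforest -> oforest -> R) a b k :
  graded_product m ->
  (forall x y, a x != 0 -> b y != 0 ->
    eval_deg F (fsize x + fsize y) (m x y) = op (F x) (F y)) ->
  eval_deg F k (bilin_ext m a b) = \sum_(i < k.+1) op (eval_deg F i a) (eval_deg F (k - i) b).
Proof.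
move=> mg mF; rewrite eval_deg_bilin//; apply: eq_bigr => i _.
rewrite bilinear_suml//; last exact: eval_deg_subspace.
apply: eq_big_seq => x; rewrite mem_forests => /eqP xi.
rewrite bilinear_sumr// scaler_sumr; apply: eq_big_seq => y.
rewrite mem_forests => /eqP yi; rewrite scalerA.
have [->|a0] := eqVneq (a x) 0; first by rewrite mul0r !scale0r.
have [->|b0] := eqVneq (b y) 0; first by rewrite mulr0 !scale0r.
by rewrite -(mF x y)// xi yi subnKC// -ltnS.
Qed.

Definition homogeneous i (a : oforest -> R) := forall x, a x != 0 -> fsize x = i.

Lemma eval_deg_homog_neq i j a : homogeneous i a -> i != j -> eval_deg F j a = 0.
Proof.
move=> ai ij; rewrite /eval_deg big_seq big1// => x; rewrite mem_forests => /eqP xj.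
have [->|/ai xi] := eqVneq (a x) 0; first by rewrite scale0r.
by rewrite -xi -xj eqxx in ij.
Qed.

Lemma eval_deg_bilin_homog (m : oforest -> oforest -> oforest -> R) a b i j :
  graded_product m -> homogeneous i a ->
  (forall x y, a x != 0 -> b y != 0 ->
    eval_deg F (fsize x + fsize y) (m x y) = op (F x) (F y)) ->
  eval_deg F (i + j) (bilin_ext m a b) = op (eval_deg F i a) (eval_deg F j b).
Proof.
move=> mg ai mF; rewrite eval_deg_bilin_op//.
have ilt : (i < (i + j).+1)%N by rewrite ltnS leq_addr.
rewrite (bigD1 (Ordinal ilt))//= addKn big1 ?addr0// => l li.
rewrite (eval_deg_homog_neq ai) ?bilinear0l//; first exact: eval_deg_subspace.
by apply: contraNneq li => il; apply/eqP/val_inj.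
Qed.

End Bilinear.

(** * Grafting *)

Section Grafting.
Context {R : realType}.
Implicit Types (t s : otree) (v w x y z : oforest) (a b : oforest -> R).

(** Concatenation presented as a graded product, so that [conc] and [graft] are
    both instances of [bilin_ext]. *)
Definition cat_basis x y : oforest -> R := single R (x ++ y).

Lemma conc_bilin a b : conc a b = bilin_ext cat_basis a b.
Proof.
apply/funext => w; rewrite /conc fsbig_mkcond /bilin_ext.
apply: eq_fsbigr => -[x y] _; rewrite patchE /cat_basis /single /=.
case: ifPn => [/set_mem /= ->|nw]; first by rewrite eqxx mulr1.
case: eqP => [wE|_]; last by rewrite mulr0.
by case/negP: nw; apply/mem_set.
Qed.

Lemma single_neq0 x y : single R x y != 0 -> y = x.
Proof. by rewrite /single; have [//|_] := eqVneq y x; case/eqP. Qed.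

Lemma homogeneous_single x : homogeneous (fsize x) (single R x).
Proof. by move=> y /single_neq0 ->. Qed.

Lemma cat_graded : graded_product cat_basis.
Proof. by move=> x y w /single_neq0 ->; rewrite fsize_cat. Qed.

Lemma bilin_ext_neq0 (m : oforest -> oforest -> oforest -> R) a b w :
  bilin_ext m a b w != 0 -> exists x y, [/\ a x != 0, b y != 0 & m x y w != 0].
Proof.
move=> nz; apply: contrapT => H; move/eqP: nz; apply.
apply: fsbig1 => -[x y] _ /=; apply/eqP; apply: contrapT => /negP.
rewrite !mulf_eq0 !negb_or => /andP[/andP[ax bx] mx].
by apply: H; exists x, y.
Qed.

Lemma bilin_ext_single (m : oforest -> oforest -> oforest -> R) x y :
  bilin_ext m (single R x) (single R y) = m x y.
Proof.
apply/funext => w; rewrite /bilin_ext (fsbigTE [fset (x, y)]%fset).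
  by rewrite big_seq_fset1 /single !eqxx !mul1r.
move=> [x' y']; rewrite inE /single /= xpair_eqE negb_and.
by case/orP => /negbTE ->; rewrite ?mul0r ?mulr0 ?mul0r.
Qed.

(** The recursion behind grafting.  For a single grafted tree it descends
    through the vertices of the target; for a longer word it removes the first
    tree, and the correction term (t grafted on x) grafted on y stays within
    reach because grafting a tree preserves the length of a word. *)
Lemma grafting_ind (P : oforest -> oforest -> Prop) :
  (forall y, P [::] y) ->
  (forall t, P [:: t] [::]) ->
  (forall t v, P [:: t] v -> P [:: t] [:: Bplus v]) ->
  (forall t s y, P [:: t] [:: s] -> P [:: t] y -> P [:: t] (s :: y)) ->
  (forall t x y, (forall z, P [:: t] z) -> P x y ->
     (forall z, size z = size x -> P z y) -> P (t :: x) y) ->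
  forall x y, P x y.
Proof.
move=> Pnil Ptree_nil Ptree_tree Ptree_cons Pcons.
have Ptree t y : P [:: t] y.
  move: y; suff [] : (forall s, P [:: t] [:: s]) /\ (forall y, P [:: t] y) by [].
  apply: GraftingExistence.otree_ind' => [v|//|s y]; first exact: Ptree_tree.
  exact: Ptree_cons.
move=> x y; move: {2}(size x) (erefl (size x)) => n; elim: n x => [|n IH] [|t x]//=.
by move=> [xn]; apply: Pcons => // [|z zx]; apply: IH; rewrite // zx.
Qed.

Variable gr : oforest -> oforest -> oforest -> R.
Hypothesis grP : is_grafting gr.

(** Solving the last grafting rule, applied to the one-vertex tree, for its
    only unknown term: grafting t on a tree either attaches t to the root or
    grafts it on the branches. *)
Lemma grafting_tree t v : gr [:: t] [:: Bplus v] =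
  single R [:: Bplus (t :: v)] + bilin_ext gr (gr [:: t] v) (single R [:: bullet]).
Proof.
have := grafting_cons grP t v [:: bullet].
by rewrite !(grafting_bullet grP) bilin_ext_single => ->; rewrite subrK.
Qed.

Lemma addf_neq0 a b w : (a + b) w != 0 -> a w != 0 \/ b w != 0.
Proof.
move=> ab; have [a0|] := eqVneq (a w) 0; last by left.
by right; move: ab; rewrite {1}/GRing.add /= a0 add0r.
Qed.

Lemma subf_neq0 a b w : (a - b) w != 0 -> a w != 0 \/ b w != 0.
Proof.
move=> /addf_neq0[|]; first by left.
by rewrite {1}/GRing.opp /= oppr_eq0; right.
Qed.

Lemma grafting_support x y w : gr x y w != 0 ->
  size w = size y /\ fsize w = (fsize x + fsize y)%N.
Proof.
move: x y w; apply: grafting_ind.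
- by move=> y w; rewrite (grafting_nil grP) => /single_neq0 ->.
- by move=> t w; rewrite (grafting_tree_nil grP) eqxx.
- move=> t v IH w; rewrite grafting_tree => /addf_neq0[/single_neq0 ->|].
    by rewrite !fsize_tree !fsize_cons addnS addn0.
  move=> /bilin_ext_neq0[x [y [/IH[xs xf] /single_neq0 -> ]]].
  by rewrite (grafting_bullet grP) => /single_neq0 ->; rewrite !fsize_tree xf addnS.
- move=> t s y IHs IHy w.
  rewrite -(cat1s s y) (grafting_tree_cat grP) !conc_bilin => /addf_neq0[|].
    move=> /bilin_ext_neq0[x' [y' [/IHs[xs xf] /single_neq0 -> /single_neq0 ->]]].
    by rewrite !size_cat !fsize_cat xs xf addnA.
  move=> /bilin_ext_neq0[x' [y' [/single_neq0 -> /IHy[xs xf] /single_neq0 ->]]].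
  by rewrite !size_cat !fsize_cat xs xf addnCA.
- move=> t x y IHt IHx IHz w; rewrite (grafting_cons grP) => /subf_neq0[|].
    move=> /bilin_ext_neq0[x' [y' [/single_neq0 -> /IHx[xs xf] /IHt[ys yf]]]].
    by rewrite ys xs yf xf !fsize_cons addn0 addnA.
  move=> /bilin_ext_neq0[x' [y' [/IHt[xs xf] /single_neq0 -> /IHz[//|ys yf]]]].
  by rewrite ys yf xf !fsize_cons addn0.
Qed.

Lemma grafting_graded : graded_product gr.
Proof. by move=> x y w /grafting_support[]. Qed.

End Grafting.

(** * D-algebras *)

(** [A] is the algebra, [L] its distinguished derivations, [op x y] the action
    x[y].  Everything is asked on subsets of an ambient space, with [A] in the
    role of the smooth maps among all maps. *)
Record dalgebra (R : realType) (E : lmodType R) (A L : set E) (one : E)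
    (mul op : E -> E -> E) : Prop := DAlgebra {
  dalg_subspace : subspace_set A;
  dalg_deriv_sub : L `<=` A;
  dalg_one : A one;
  dalg_mul : forall x y, A x -> A y -> A (mul x y);
  dalg_op : forall x y, A x -> A y -> A (op x y);
  dalg_op_deriv : forall x d, A x -> L d -> L (op x d);
  dalg_mul_bilinear : bilinear_on A mul;
  dalg_op_bilinear : bilinear_on A op;
  dalg_mulA : forall x y z, A x -> A y -> A z -> mul x (mul y z) = mul (mul x y) z;
  dalg_mul1l : forall x, A x -> mul one x = x;
  dalg_mul1r : forall x, A x -> mul x one = x;
  dalg_op1l : forall x, A x -> op one x = x;
  dalg_leibniz : forall d x y, L d -> A x -> A y ->
    op d (mul x y) = mul (op d x) y + mul x (op d y);
  dalg_op_op : forall d x y, L d -> A x -> A y ->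
    op d (op x y) = op (mul d x) y + op (op d x) y }.

Section DAlgebraMorphism.
Context {R : realType} {E : lmodType R}.
Variables (A L : set E) (one : E) (mul op : E -> E -> E).
Hypothesis D : dalgebra A L one mul op.
Variables (F : oforest -> E) (f : E).
Hypotheses (Lf : L f) (F_nil : F [::] = one)
  (F_cons : forall t w, F (t :: w) = mul (F [:: t]) (F w))
  (F_tree : forall w, F [:: Bplus w] = op (F w) f).

(** The Leibniz rule for 1 = 1 1. *)
Lemma dalg_op_one d : L d -> op d one = 0.
Proof.
move=> Ld; have Ad := dalg_deriv_sub D Ld; have A1 := dalg_one D.
have := dalg_leibniz D Ld A1 A1; have Ad1 := dalg_op D Ad A1.
rewrite (dalg_mul1l D A1) (dalg_mul1l D Ad1) (dalg_mul1r D Ad1).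
by move=> /(congr1 (fun z => z - op d one)); rewrite subrr addrK.
Qed.

Lemma elementary_closed : (forall t, L (F [:: t])) /\ (forall w, A (F w)).
Proof.
apply: GraftingExistence.otree_ind' => [v Av||t w Lt Aw].
- by rewrite F_tree; apply: dalg_op_deriv D _ _ Av Lf.
- by rewrite F_nil; apply: dalg_one D.
- by rewrite F_cons; apply: dalg_mul D _ _ _ Aw; apply: dalg_deriv_sub D _ _.
Qed.

Let LF t : L (F [:: t]) := elementary_closed.1 t.
Let AF w : A (F w) := elementary_closed.2 w.

Lemma elementary_cat x y : F (x ++ y) = mul (F x) (F y).
Proof.
elim: x => [|t x IH] /=; first by rewrite F_nil (dalg_mul1l D).
by rewrite F_cons IH (dalg_mulA D)// -F_cons.
Qed.

Lemma eval_deg_cat_basis x y :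
  eval_deg F (fsize x + fsize y) (cat_basis x y : _ -> R) = mul (F x) (F y).
Proof. by rewrite eval_deg_single fsize_cat eqxx elementary_cat. Qed.

Variable gr : oforest -> oforest -> oforest -> R.
Hypothesis grP : is_grafting gr.

(** A multiplicative map on words with F(B+(w)) = F(w)[f] transports
    grafting to the action: each grafting rule is matched by one D-algebra
    axiom (the Leibniz rule for a product, d[x[y]] = (d x)[y] + (d[x])[y] for a
    tree and for a longer word). *)
Lemma eval_deg_grafting x y : eval_deg F (fsize x + fsize y) (gr x y) = op (F x) (F y).
Proof.
have Asub := dalg_subspace D; have bil := dalg_op_bilinear D.
have mbil := dalg_mul_bilinear D.
have gg := grafting_graded grP.
have hgr x' y' : homogeneous (fsize x' + fsize y')%N (gr x' y') by move=> w /gg.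
have eval_single z : eval_deg F (fsize z) (single R z) = F z by rewrite eval_deg_single eqxx.
move: x y; apply: grafting_ind.
- by move=> y; rewrite (grafting_nil grP) eval_single F_nil (dalg_op1l D).
- move=> t; rewrite (grafting_tree_nil grP) F_nil dalg_op_one//.
  by rewrite /eval_deg big1// => w _; rewrite scale0r.
- move=> t v IH; rewrite (grafting_tree grP) eval_degD F_tree (dalg_op_op D)//; last first.
    exact: dalg_deriv_sub D _ Lf.
  rewrite -F_cons -F_tree; congr (_ + _).
    by rewrite eval_deg_single !fsize_tree !fsize_cons addn0 addnS eqxx.
  have -> : (fsize [:: t] + fsize [:: Bplus v] = (fsize [:: t] + fsize v) + 1)%N.
    by rewrite fsize_tree addnS addn1.
  have Fb : F [:: bullet] = f.
    by rewrite F_tree F_nil (dalg_op1l D)//; exact: dalg_deriv_sub D _ Lf.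
  rewrite (eval_deg_bilin_homog Asub bil AF _ gg (hgr _ _)).
    by rewrite -[1%N]/(fsize [:: bullet]) eval_single IH Fb.
  move=> x y _ /single_neq0 ->.
  rewrite (grafting_bullet grP) eval_deg_single !fsize_tree addnS addn0 eqxx.
  by rewrite F_tree Fb.
- move=> t s y IHs IHy; rewrite -(cat1s s y) (grafting_tree_cat grP) eval_degD !conc_bilin.
  rewrite elementary_cat (dalg_leibniz D)//; congr (_ + _).
    rewrite fsize_cat addnA (eval_deg_bilin_homog Asub mbil AF _ cat_graded (hgr _ _)).
      by rewrite IHs eval_single.
    by move=> *; exact: eval_deg_cat_basis.
  rewrite fsize_cat addnCA.
  rewrite (eval_deg_bilin_homog Asub mbil AF _ cat_graded (homogeneous_single (x := _))).
    by rewrite IHy eval_single.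
  by move=> *; exact: eval_deg_cat_basis.
- move=> t x y IHt IHx IHz; rewrite (grafting_cons grP) eval_degB F_cons.
  have -> : (fsize (t :: x) + fsize y = fsize [:: t] + (fsize x + fsize y))%N.
    by rewrite !fsize_cons addn0 addnA.
  rewrite (eval_deg_bilin_homog Asub bil AF _ gg (homogeneous_single (x := _))); last first.
    by move=> x' y' /single_neq0 -> _.
  rewrite eval_single IHx (dalg_op_op D)// addnA (eval_deg_bilin_homog Asub bil AF _ gg (hgr _ _)).
    by rewrite eval_single IHt addrK.
  move=> x' y' /(grafting_support grP)[xs _] /single_neq0 ->; exact: IHz.
Qed.

End DAlgebraMorphism.

(** * The substitution law for D-algebra morphisms *)

Section Substitution.
Context {R : realType}.
Variable beta : oforest -> R.
Hypothesis beta_nil : beta [::] = 0.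
Implicit Types (t : otree) (w x y z : oforest) (a b : oforest -> R).

Lemma graft_neq0 a b w : graft a b w != 0 ->
  exists x y, [/\ a x != 0, b y != 0 & fsize w = (fsize x + fsize y)%N].
Proof.
move=> /bilin_ext_neq0[x [y [ax bx /(grafting_support (grafting_basisP R))[_ wE]]]].
by exists x, y.
Qed.

(** Each vertex is replaced by terms of degree at least one, since beta has no
    constant term; so substitution does not lower the degree. *)
Lemma subst_support :
  (forall t z, subst_tree beta t z != 0 -> (tsize t <= fsize z)%N) /\
  (forall w z, subst_forest beta w z != 0 -> (fsize w <= fsize z)%N).
Proof.
apply: GraftingExistence.otree_ind' => [v IH z||t w IHt IHw z] /=.
- move=> /graft_neq0[x [y [/IH xv yb ->]]].
  rewrite -addn1; apply: leq_add => //; rewrite lt0n fsize_eq0.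
  by apply: contraNneq yb => ->; rewrite beta_nil.
- by [].
- rewrite conc_bilin => /bilin_ext_neq0[x [y [/IHt xt /IHw yw /cat_graded ->]]].
  by rewrite fsize_cons leq_add.
Qed.

Lemma substE alpha z k : fsize z = k -> subst beta alpha z =
  \sum_(w \in [set w | (fsize w <= k)%N]) alpha w * subst_forest beta w z.
Proof.
move=> zk; rewrite /subst; apply/esym/fsbig_widen => // w [_ /= wk].
have [/subst_support.2|] := boolP (subst_forest beta w z != 0).
  by rewrite zk => /wk.
by rewrite negbK => /eqP ->; rewrite mulr0.
Qed.

End Substitution.

(** A bracket has no constant term as soon as one factor has none, because
    the empty word only splits into empty words. *)
Lemma lie_polynomial_nil (R : realType) (a : oforest -> R) :
  lie_polynomial a -> a [::] = 0.
Proof.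
have ext0 (x y : oforest -> R) : x [::] = 0 -> bilin_ext (@cat_basis R) x y [::] = 0.
  move=> x0; apply/eqP; apply: contrapT => /negP/bilin_ext_neq0[u [v [xu _]]].
  move=> /single_neq0 /esym/(congr1 size); rewrite size_cat => /eqP.
  by rewrite addn_eq0 => /andP[/nilP u0 _]; rewrite u0 x0 eqxx in xu.
elim=> {a} [t||c a b _ a0 _ b0|a b _ a0 _ b0].
- by rewrite /single.
- by [].
- by rewrite -[LHS]/(c * a [::] + b [::]) a0 b0 mulr0 addr0.
- by rewrite -[LHS]/(conc a b [::] - conc b a [::]) !conc_bilin !ext0// subrr.
Qed.

Lemma lie_series_nil (R : realType) (a : oforest -> R) : lie_series a -> a [::] = 0.
Proof. by move=> /(_ 0%N) /lie_polynomial_nil. Qed.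

Section SubstitutionLaw.
Context {R : realType} {n : nat} {M : topologicalType} (atlas : set (chart R n M)).
Context (g : set (vfield R M)) {U : algType R} (iota : vfield R M -> U).
Context (f : M -> vfield R M).

Local Notation mact := (mact atlas g iota).
Local Notation F := (eldiff atlas g iota f).
Local Notation LB := (LB atlas g iota f).

Lemma eldiff_cons t w : F (t :: w) = mmul (F [:: t]) (F w).
Proof.
by rewrite /eldiff /=; apply/funext => p; rewrite /mmul mulr1.
Qed.

Lemma eldiff_cat x y : F (x ++ y) = mmul (F x) (F y).
Proof.
elim: x => [|t x IH]; first by apply/funext => p; rewrite /mmul mul1r.
rewrite cat_cons eldiff_cons [in RHS]eldiff_cons IH.
by apply/funext => p; rewrite /mmul mulrA.
Qed.

Lemma mmul_bilinear (B : set (M -> U)) : bilinear_on B (@mmul R M U).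
Proof.
split=> c x y z _ _ _; apply/funext => p; rewrite /mmul.
  by rewrite -[LHS]/((c *: x p + y p) * z p) mulrDl -scalerAl.
by rewrite -[LHS]/(z p * (c *: x p + y p)) mulrDr -scalerAr.
Qed.

Lemma eldiff_tree1 w : F [:: Bplus w] = mact (F w) (iota \o f).
Proof. by apply/funext => p; rewrite /eldiff /= /mmul mulr1. Qed.

Lemma LBE beta k : LB beta k = eval_deg F k beta.
Proof. exact: fsbig_forests. Qed.

Variable A : set (M -> U).
Hypothesis Asub : subspace_set A.
Hypothesis mact_bil : bilinear_on A mact.
Hypothesis F_closed : forall w, A (F w).
Hypothesis F_graft : forall x y, y != [::] ->
  eval_deg F (fsize x + fsize y) (grafting_basis R x y) = mact (F x) (F y).

Lemma LB_conc a b : LB (conc a b) = hmul (LB a) (LB b).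
Proof.
apply/funext => k; rewrite LBE conc_bilin.
rewrite (eval_deg_bilin_op Asub (mmul_bilinear A) F_closed _ (@cat_graded R)).
  by apply: eq_bigr => i _; rewrite !LBE.
by move=> x y _ _; rewrite eval_deg_single fsize_cat eqxx eldiff_cat.
Qed.

(** The condition on b keeps the empty word out of the right argument of the
    action, so that this also covers a zero action, for which 1[1] = 1 fails. *)
Lemma LB_graft a b : b [::] = 0 ->
  LB (graft a b) = hact atlas g iota (LB a) (LB b).
Proof.
move=> b0; apply/funext => k; rewrite LBE.
rewrite (eval_deg_bilin_op Asub mact_bil F_closed _ (grafting_graded (grafting_basisP R))).
  by apply: eq_bigr => i _; rewrite !LBE.
by move=> x y _ by0; apply: F_graft; apply: contraNneq by0 => ->; rewrite b0.
Qed.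

Lemma LB_one : LB (single R [::]) = @hone R M U.
Proof.
apply/funext => k; rewrite LBE eval_deg_single /hone; apply/funext => p.
by rewrite /eldiff /fsize /= eq_sym; case: (k == 0)%N.
Qed.

Variable beta : oforest -> R.
Hypothesis beta_nil : beta [::] = 0.

(** [heldiff_tree] and [subst_tree] are the same recursion, one on formal
    vector fields and one on series. *)
Lemma heldiff_subst :
  (forall t, heldiff_tree atlas g iota (LB beta) t = LB (subst_tree beta t)) /\
  (forall w, heldiff atlas g iota (LB beta) w = LB (subst_forest beta w)).
Proof.
apply: GraftingExistence.otree_ind' => [v IH||t w IHt IHw] /=.
- by rewrite LB_graft// -/(subst_forest beta v) -IH.
- by rewrite LB_one.
- by rewrite LB_conc -IHt -IHw.
Qed.

Theorem LB_substitution alpha :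
  hLB atlas g iota (LB beta) alpha = LB (subst beta alpha).
Proof.
apply/funext => k; rewrite LBE /hLB.
have heldiffE w : heldiff atlas g iota (LB beta) w k = eval_deg F k (subst_forest beta w).
  by rewrite heldiff_subst.2 LBE.
pose S := [set w | (fsize w <= k)%N]; have Sfin : finite_set S := finite_forests_le k.
transitivity (\sum_(w \in S) alpha w *: eval_deg F k (subst_forest beta w)).
  under eq_fsbigr do rewrite heldiffE.
  apply/esym/fsbig_widen => // w [_ /= wk].
  rewrite [X in _ *: X]big1_seq ?scaler0// => z; rewrite mem_forests => /eqP zk.
  have [/(subst_support beta_nil).2|] := boolP (subst_forest beta w z != 0).
    by rewrite zk => /wk.
  by rewrite negbK => /eqP ->; rewrite scale0r.
rewrite fsbig_finite//; under eq_bigr do rewrite scaler_sumr.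
rewrite exchange_big; apply: eq_big_seq => z; rewrite mem_forests => /eqP zk.
rewrite (substE beta_nil _ zk) fsbig_finite// scaler_suml.
by apply: eq_bigr => w _; rewrite scalerA.
Qed.

End SubstitutionLaw.

(** * Vector-valued calculus and primitives *)

Section RowVectors.
Context {R : realType}.

Lemma rV_norm_le n (v : 'rV[R]_n) (c : R) :
  0 <= c -> (forall j, `|v 0 j| <= c) -> `|v| <= c.
Proof.
move=> c0 vc; rewrite [leLHS]/Num.Def.normr/= mx_normrE.
by rewrite bigmax_le//= => -[i j] _ /=; rewrite ord1.
Qed.

Lemma rV_coord_le n (v : 'rV[R]_n) j : `|v 0 j| <= `|v|.
Proof.
rewrite [leRHS]/Num.Def.normr/= mx_normrE.
exact: (le_bigmax _ (fun i : 'I_1 * 'I_n => `|v i.1 i.2|) (0, j)).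
Qed.

Lemma rV_continuous (T : topologicalType) n (f : T -> 'rV[R]_n) (x : T) :
  (forall j, {for x, continuous (fun y => f y 0 j)}) -> {for x, continuous f}.
Proof.
move=> fc; apply/cvgrPdist_le => e e0; near=> y.
apply: rV_norm_le (ltW e0) _ => j; rewrite !mxE.
move: j; near: y; apply: filter_forall => j.
by move/cvgrPdist_le : (fc j) => /(_ e e0).
Unshelve. all: by end_near. Qed.

Lemma is_derive_rV n (f : R -> 'rV[R]_n) (df : 'rV[R]_n) (t : R) :
  (forall j, is_derive t (1 : R) (fun s => f s 0 j) (df 0 j)) -> is_derive t (1 : R) f df.
Proof.
move=> fd; have dr : derivable f t 1.
  by apply/derivable_mxP => i j; rewrite ord1; case: (fd j).
apply: DeriveDef => //; rewrite derive_mx//; apply/rowP => j.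
by rewrite mxE; case: (fd j).
Qed.

Lemma is_derive_coord n (f : R -> 'rV[R]_n) (df : 'rV[R]_n) (t : R) j :
  is_derive t (1 : R) f df -> is_derive t (1 : R) (fun s => f s 0 j) (df 0 j).
Proof.
move=> [fd <-]; rewrite derive_mx// mxE; apply: DeriveDef => //.
by move/derivable_mxP : fd.
Qed.

End RowVectors.

Section Picard.
Context {R : realType}.

Lemma lipschitz_continuous (V W : normedModType R) (f : V -> W) (k : R) :
  (forall x y, `|f x - f y| <= k * `|x - y|) -> continuous f.
Proof.
move=> fk x; apply/cvgrPdist_le => e e0.
have k0 : 0 < `|k| + 1 by rewrite ltr_wpDl.
near=> y; apply: le_trans (fk _ _) _.
apply: (@le_trans _ _ ((`|k| + 1) * `|x - y|)).
  by rewrite ler_wpM2r// (le_trans (ler_norm _))// lerDl.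
rewrite -ler_pdivlMl//; near: y.
by apply: cvgr_dist_le; rewrite ?mulr_gt0 ?invr_gt0.
Unshelve. all: by end_near. Qed.

Lemma derive_bounded_le (f df : R -> R) (a b c : R) : a <= b ->
  (forall s, a <= s <= b -> is_derive s (1 : R) f (df s)) ->
  (forall s, a <= s <= b -> `|df s| <= c) -> `|f b - f a| <= c * (b - a).
Proof.
move=> ab fd dfc.
have [||s sab ->] := @MVT_segment _ f df a b ab.
- by move=> x; rewrite in_itv /= => /andP[/ltW ax /ltW xb]; apply: fd; rewrite ax.
- apply: derivable_within_continuous => x; rewrite in_itv /= => xab.
  by case: (fd x xab).
- by rewrite normrM (ger0_norm (_ : 0 <= b - a)) ?subr_ge0// ler_wpM2r ?subr_ge0 ?dfc//.
Qed.

Lemma derive_bounded_le0 (f df : R -> R) (c t : R) : `|t| < 1 ->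
  (forall s, `|s| < 1 -> is_derive s (1 : R) f (df s)) ->
  (forall s, `|df s| <= c) -> `|f t - f 0| <= c * `|t|.
Proof.
move=> t1 fd dfc; have [t0|t0] := leP 0 t.
  have tE : `|t| = t - 0 by rewrite subr0 ger0_norm.
  rewrite tE; apply: derive_bounded_le (fun s _ => dfc s) => // s /andP[s0 st].
  by apply: fd; rewrite ger0_norm//; apply: le_lt_trans st _; move: t1; rewrite ger0_norm.
have tE : `|t| = 0 - t by rewrite sub0r ltr0_norm.
rewrite distrC tE; apply: derive_bounded_le (fun s _ => dfc s) => //; first exact: ltW.
move=> s /andP[ts s0]; apply: fd; apply: le_lt_trans t1.
by rewrite (ltr0_norm t0) ler0_norm// lerN2.
Qed.

(** Integrating from -1 makes every point of the open unit interval interior,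
    where the fundamental theorem of calculus gives a two-sided derivative. *)
Lemma primitive_exists (u : R -> R) : continuous u ->
  exists F : R -> R, F 0 = 0 /\
    forall t, `|t| < 1 -> is_derive t (1 : R) F (u t).
Proof.
move=> uc; pose G x := (\int[lebesgue_measure]_(t in [set` `[(-1 : R), x]]) u t)%R.
exists (fun x => G x - G 0); split; first by rewrite subrr.
move=> t; rewrite ltr_norml => /andP[t1 t2].
have [] := @continuous_FTC1_closed R u (-1) t 1 t2 _ t1 (uc t).
  apply: continuous_compact_integrable; first exact: segment_compact.
  exact: continuous_subspaceT.
rewrite derive1E => Gd Ge.
have : is_derive t (1 : R) G (u t) by apply: DeriveDef.
move=> Gt; rewrite -[u t]subr0; apply: is_deriveB.
Qed.

Definition prim (u : R -> R) : R -> R := xget 0 [set F | F 0 = 0 /\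
  forall t, `|t| < 1 -> is_derive t (1 : R) F (u t)].

Lemma primP u : continuous u -> prim u 0 = 0 /\
  forall t, `|t| < 1 -> is_derive t (1 : R) (prim u) (u t).
Proof. by move=> /primitive_exists/(xgetPex 0). Qed.

Lemma prim_bounded u c t : continuous u -> (forall s, `|u s| <= c) ->
  `|t| < 1 -> `|prim u t| <= c * `|t|.
Proof.
move=> uc ub t1; have [u0 ud] := primP uc.
by rewrite -[prim u t]subr0 -u0; apply: derive_bounded_le0 ub.
Qed.

Lemma prim_dist u v c t : continuous u -> continuous v ->
  (forall s, `|u s - v s| <= c) -> `|t| < 1 ->
  `|prim u t - prim v t| <= c * `|t|.
Proof.
move=> uc vc ub t1; have [u0 ud] := primP uc; have [v0 vd] := primP vc.
pose f s := prim u s - prim v s.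
have -> : prim u t - prim v t = f t - f 0 by rewrite /f u0 v0 !subr0.
apply: derive_bounded_le0 (fun s => u s - v s) _ _ t1 _ ub => s s1.
by apply: is_deriveB; [exact: ud|exact: vd].
Qed.

(** The nearest point projection onto [-r, r].  It is 1-Lipschitz, and serves to
    extend data given near a point, in time or in space, to everywhere. *)
Definition clamp (r t : R) : R := Num.max (- r) (Num.min r t).

Lemma clamp_cases r t : 0 <= r ->
  [\/ t <= - r /\ clamp r t = - r, - r <= t <= r /\ clamp r t = t
    | r <= t /\ clamp r t = r].
Proof.
move=> r0; have rr : - r <= r by lra.
rewrite /clamp; have [rt|/ltW rt] := leP r t.
  by apply: Or33; split=> //; rewrite max_r.
have [tr|/ltW tr] := leP t (- r); first by apply: Or31.
by apply: Or32; rewrite tr rt.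
Qed.

Lemma clamp_le r t : 0 <= r -> `|clamp r t| <= r.
Proof.
move=> r0; rewrite ler_norml.
by case: (clamp_cases t r0) => -[+ ->] => [_|//|_]; apply/andP; split; lra.
Qed.

Lemma clamp_id r t : `|t| <= r -> clamp r t = t.
Proof.
by rewrite ler_norml /clamp => /andP[t1 t2]; rewrite min_r// max_r.
Qed.

Lemma clamp_dist r s t : 0 <= r -> `|clamp r s - clamp r t| <= `|s - t|.
Proof.
move=> r0; rewrite ler_norml.
have := ler_norm (s - t); have := ler_norm (t - s); rewrite (distrC t s).
by case: (clamp_cases s r0) => -[+ ->]; case: (clamp_cases t r0) => -[+ ->];
  move=> *; apply/andP; split; lra.
Qed.

Lemma clamp_continuous r : 0 <= r -> continuous (clamp r).
Proof.
by move=> r0; apply: (@lipschitz_continuous _ _ _ 1) => x y; rewrite mul1r clamp_dist.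
Qed.

End Picard.

(** * Existence of integral curves: the Picard--Lindelof theorem *)

Section PicardLindelof.
Context {R : realType} {n : nat}.
Variables (B : 'rV[R]_n -> 'rV[R]_n) (L : R) (x0 : 'rV[R]_n).
Hypothesis L0 : 0 <= L.
Hypothesis B_lip : forall x y, `|B x - B y| <= L * `|x - y|.

Let a : R := (2 * (L + 1))^-1.

Let a_gt0 : 0 < a. Proof. by rewrite /a invr_gt0 mulr_gt0// ltr_wpDl. Qed.

Let a_lt1 : a < 1.
Proof. by rewrite /a invf_lt1 ?mulr_gt0 ?ltr_wpDl//; move: L0; lra. Qed.

Let aL : L * a <= 2^-1.
Proof.
rewrite /a ler_pdivrMr ?mulr_gt0 ?ltr_wpDl//.
by rewrite mulrA mulVf ?mul1r ?lerDl// pnatr_eq0.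
Qed.

Let a_ge0 : 0 <= a := ltW a_gt0.

(** Time is clamped to [-a, a], so that iterates are defined and continuous on
    the whole line and distances between them are uniform. *)
Definition picard_step (x : R -> 'rV[R]_n) : R -> 'rV[R]_n :=
  fun t => x0 + \row_j prim (fun s => B (x s) 0 j) (clamp a t).

Let clamp_lt1 t : `|clamp a t| < 1.
Proof. exact: le_lt_trans (clamp_le _ _) a_lt1. Qed.

Let field_continuous (x : R -> 'rV[R]_n) j :
  continuous x -> continuous (fun s => B (x s) 0 j).
Proof.
move=> xc s; apply: (@continuous_comp _ _ _ (B \o x) (fun v => v 0 j)).
  apply: continuous_comp; first exact: xc.
  exact: lipschitz_continuous B_lip _.
exact: coord_continuous.
Qed.

Lemma picard_step_continuous x : continuous x -> continuous (picard_step x).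
Proof.
move=> xc t; apply: rV_continuous => j.
rewrite (_ : (fun y => _) = fun y =>
  x0 0 j + prim (fun s => B (x s) 0 j) (clamp a y)); last first.
  by apply/funext => y; rewrite !mxE.
apply: continuousD; first exact: cst_continuous.
apply: (@continuous_comp _ _ _ (clamp a)); first exact: clamp_continuous.
have [_ pd] := primP (@field_continuous _ j xc).
apply/differentiable_continuous/derivable1_diffP.
by case: (pd _ (clamp_lt1 t)).
Qed.

(** Integrating over a time at most a multiplies distances by at most L a,
    which the choice of a makes at most 1/2. *)
Lemma picard_step_dist x y c : continuous x -> continuous y ->
  (forall t, `|x t - y t| <= c) ->
  forall t, `|picard_step x t - picard_step y t| <= c / 2.
Proof.
move=> xc yc xy t; have c0 : 0 <= c := le_trans (normr_ge0 _) (xy 0).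
apply: rV_norm_le => [|j]; first by lra.
rewrite !mxE opprD addrACA subrr add0r.
have Lc s : `|B (x s) 0 j - B (y s) 0 j| <= L * c.
  have := rV_coord_le (B (x s) - B (y s)) j; rewrite !mxE => /le_trans; apply.
  by apply: le_trans (B_lip _ _) _; rewrite ler_wpM2l.
apply: le_trans (prim_dist (@field_continuous _ j xc) (@field_continuous _ j yc) Lc
  (clamp_lt1 t)) _.
apply: (@le_trans _ _ (L * c * a)).
  by rewrite ler_wpM2l ?mulr_ge0// clamp_le.
by rewrite mulrAC mulrC ler_wpM2l.
Qed.

Lemma picard_step0 t : `|picard_step (cst x0) t - x0| <= `|B x0|.
Proof.
rewrite [picard_step _ _]addrC addrK; apply: rV_norm_le => // j; rewrite mxE.
have Bc (s : R) : `|B (cst x0 s) 0 j| <= `|B x0| by exact: rV_coord_le.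
have xc : continuous (cst x0 : R -> 'rV[R]_n) by move=> s; exact: cst_continuous.
have := prim_bounded (@field_continuous _ j xc) Bc (clamp_lt1 t).
by move=> /le_trans; apply; rewrite ler_piMr// ltW.
Qed.

Let X k : R -> 'rV[R]_n := iter k picard_step (cst x0).
Let C := `|B x0|.

Let X_continuous k : continuous (X k).
Proof.
elim: k => [|k IH]; first by move=> s; exact: cst_continuous.
exact: picard_step_continuous.
Qed.

Let X_succ k t : `|X k.+1 t - X k t| <= C * 2^-1 ^+ k.
Proof.
elim: k t => [|k IH] t; first by rewrite mulr1 picard_step0.
rewrite exprSr mulrA.
exact: picard_step_dist (@X_continuous k.+1) (@X_continuous k) IH t.
Qed.

Let X_dist k m t : `|X (k + m) t - X k t| <= 2 * C * 2^-1 ^+ k * (1 - 2^-1 ^+ m).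
Proof.
elim: m => [|m IH]; first by rewrite addn0 subrr normr0 expr0 subrr mulr0.
rewrite addnS -(subrKA (X (k + m) t)); apply: le_trans (ler_normD _ _) _.
apply: le_trans (lerD (X_succ _ _) IH) _.
rewrite exprD exprSr -subr_ge0.
by rewrite [leRHS](_ : _ = 0)//; field.
Qed.

Let X_dist2 k m t : (k <= m)%N -> `|X m t - X k t| <= 2 * C * 2^-1 ^+ k.
Proof.
move=> km; rewrite -(subnKC km); apply: le_trans (X_dist _ _ _) _.
apply: ler_piMr; last by rewrite lerBlDr lerDl exprn_ge0// invr_ge0.
by apply: mulr_ge0; rewrite ?mulr_ge0 ?normr_ge0 ?exprn_ge0 ?invr_ge0.
Qed.

Let small (e : R) : 0 < e -> \forall k \near \oo, 2 * C * 2^-1 ^+ k <= e.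
Proof.
move=> e0; have q1 : `|2^-1 : R| < 1 by rewrite ger0_norm ?invr_ge0 ?invf_lt1 ?ltr1n.
have := @cvg_geometric R (2 * C) 2^-1 q1.
move/cvgrPdist_le => /(_ e e0); apply: filterS => k.
by rewrite sub0r normrN; apply: le_trans; rewrite ler_norm.
Qed.

Let X_cvg t : cvgn (X^~ t).
Proof.
apply/cauchy_cvgP/cauchy_exP => e e0.
have [N _ NP] := small (divr_gt0 e0 (ltr0n R 2)).
exists (X N t); exists N => // m /= Nm.
rewrite -ball_normE /= distrC; apply: le_lt_trans (X_dist2 t Nm) _.
by apply: le_lt_trans (NP N _) _ => //=; rewrite ltr_pdivrMr// ltr_pMr// ltr1n.
Qed.

Let x t := limn (X^~ t).

Let x_dist k t : `|x t - X k t| <= 2 * C * 2^-1 ^+ k.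
Proof.
have : `|X m t - X k t| @[m --> \oo] --> `|x t - X k t|.
  by apply: cvg_norm; apply: cvgB (cvg_cst _); exact: X_cvg.
move=> cv; apply: (cvgr_to_le cv).
by exists k => // m; exact: X_dist2.
Qed.

Let x_continuous : continuous x.
Proof.
move=> t; apply/cvgrPdist_le => e e0; have e30 : 0 < e / 3 by lra.
have [N _ /(_ N (leqnn _)) NP] := small e30.
near=> s.
have -> : x t - x s = (x t - X N t) + ((X N t - X N s) - (x s - X N s)).
  by rewrite opprB !addrA !subrK.
apply: le_trans (ler_normD _ _) _.
have h1 := le_trans (x_dist N t) NP; have h2 := le_trans (x_dist N s) NP.
have h3 := ler_normB (X N t - X N s) (x s - X N s).
have h4 : `|X N t - X N s| <= e / 3.
  near: s; have := @X_continuous N t => /cvgrPdist_le; exact.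
lra.
Unshelve. all: by end_near. Qed.

Let x_fixed : picard_step x = x.
Proof.
apply/funext => t; apply/eqP; rewrite -subr_eq0 -normr_le0.
apply/ler_addgt0Pl => e e0; rewrite addr0.
have [N _ NP] := small (divr_gt0 e0 (ltr0n R 2)).
have h1 := picard_step_dist x_continuous (@X_continuous N) (x_dist N) t.
have h2 := x_dist N.+1 t; have h3 := NP N (leqnn _); have h4 := NP N.+1 (leqnSn _).
have -> : picard_step x t - x t = (picard_step x t - X N.+1 t) - (x t - X N.+1 t).
  by rewrite opprB addrA subrK.
by apply: le_trans (ler_normB _ _) _; rewrite /= in h1 h2 h3 h4 *; lra.
Qed.

(** The iterates converge uniformly to a fixed point of the Picard step,
    and a fixed point solves the equation wherever clamping time is the
    identity. *)
Lemma picard_lindelof_lipschitz : exists2 d : R, 0 < d &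
  exists y : R -> 'rV[R]_n, y 0 = x0 /\
    forall t, `|t| < d -> is_derive t (1 : R) y (B (y t)).
Proof.
exists a => //; exists x; split.
  rewrite -x_fixed /picard_step clamp_id ?normr0//.
  apply/rowP => j; rewrite !mxE.
  by have [-> _] := primP (@field_continuous _ j x_continuous); rewrite addr0.
move=> t ta; rewrite -[in X in is_derive _ _ X _]x_fixed.
apply: is_derive_rV => j.
have [_ pd] := primP (@field_continuous _ j x_continuous).
have t1 : `|t| < 1 := lt_trans ta a_lt1.
have ta' : \forall s \near t, `|s| <= a.
  have nt : `|s| @[s --> t] --> `|t| by apply: cvg_norm; exact: cvg_id.
  by have := @cvgr_lt _ _ _ (nbhs_filter t) _ _ nt _ ta; apply: filterS => s /ltW.
apply: (@near_eq_is_derive _ _ _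
  (fun s => x0 0 j + prim (fun s => B (x s) 0 j) s)).
  by apply: filterS ta' => s sa; rewrite !mxE clamp_id.
have := is_deriveD (is_derive_cst (x0 0 j) t 1) (pd t t1).
by rewrite add0r.
Qed.

End PicardLindelof.

Section PicardLocal.
Context {R : realType}.

Lemma is_derive_diff_comp (V W : normedModType R) (f : V -> W) (y : R -> V)
    (t : R) (dy : V) :
  differentiable f (y t) -> is_derive t (1 : R) y dy ->
  is_derive t (1 : R) (f \o y) ('d f (y t) dy).
Proof.
move=> fd yd; have [/derivable1_diffP yd' dyE] := yd.
have fyd : differentiable (f \o y) t by exact: differentiable_comp.
apply: DeriveDef; first exact/derivable1_diffP.
by rewrite deriveE// diff_comp//= -dyE deriveE.
Qed.

Lemma linear_row_sum n (W : lmodType R) (f : {linear 'rV[R]_n -> W}) (v : 'rV[R]_n) :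
  f v = \sum_j v 0 j *: f (delta_mx 0 j).
Proof.
rewrite [in LHS](row_sum_delta v) linear_sum.
by apply: eq_bigr => j _; rewrite linearZ.
Qed.

Variables (n : nat) (A : set 'rV[R]_n) (b : 'rV[R]_n -> 'rV[R]_n).
Variable x0 : 'rV[R]_n.
Hypotheses (Aopen : open A) (Ax0 : A x0) (bC1 : Ck_on 1 A b).

Let K : R := \sum_j (`|'d b x0 (delta_mx 0 j)| + 1).

Let K_ge0 : 0 <= K.
Proof. by apply: sumr_ge0 => j _; rewrite addr_ge0. Qed.

(** By linearity it is enough to bound the finitely many partial derivatives,
    which are continuous at x0. *)
Lemma diff_locally_bounded : exists2 r : R, 0 < r &
  forall x, `|x0 - x| <= r -> A x /\ forall v, `|'d b x v| <= K * `|v|.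
Proof.
have nA : \forall x \near x0, A x by apply: open_nbhs_nbhs.
have nb : \forall x \near x0, forall j, 
    `|'d b x (delta_mx 0 j)| <= `|'d b x0 (delta_mx 0 j)| + 1.
  apply: (@filter_forall _ _ _ (nbhs x0) (nbhs_filter x0)) => j.
  have [_ /(_ (delta_mx 0 j)) /= dc] := bC1.
  have nt : `|'d b x (delta_mx 0 j)| @[x --> x0] --> `|'d b x0 (delta_mx 0 j)|.
    by apply: cvg_norm; [exact: nbhs_filter|exact: (dc x0 Ax0)].
  have lt : `|'d b x0 (delta_mx 0 j)| < `|'d b x0 (delta_mx 0 j)| + 1.
    by rewrite ltrDl.
  by have := @cvgr_lt _ _ _ (nbhs_filter x0) _ _ nt _ lt; apply: filterS => x /ltW.
have /nbhs_ballP[e /= e0 eP] := @filterI _ _ (nbhs_filter x0) _ _ nA nb.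
exists (e / 2) => [|x xr]; first by rewrite divr_gt0.
have [Ax bx] : A x /\ forall j, `|'d b x (delta_mx 0 j)| <= `|'d b x0 (delta_mx 0 j)| + 1.
  apply: eP; rewrite -ball_normE /=; apply: le_lt_trans xr _.
  by rewrite ltr_pdivrMr// ltr_pMr// ltr1n.
split=> // v; rewrite (linear_row_sum ('d b x) v) mulr_suml.
apply: le_trans (ler_norm_sum _ _ _) _; apply: ler_sum => j _.
rewrite normrZ [leRHS]mulrC; apply: ler_pM; [exact: normr_ge0|exact: normr_ge0| |].
  exact: rV_coord_le.
exact: bx.
Qed.

(** Mean value inequality along segments; balls are convex. *)
Lemma C1_locally_lipschitz : exists2 r : R, 0 < r &
  forall x y, `|x0 - x| <= r -> `|x0 - y| <= r ->
    A x /\ `|b x - b y| <= K * `|x - y|.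
Proof.
have [r r0 rP] := diff_locally_bounded; exists r => // x y xr yr.
split; first by case: (rP x xr).
apply: rV_norm_le => [|j]; first by rewrite mulr_ge0.
(* The segment from y to x stays in the ball. *)
pose g (s : R) := y + s *: (x - y).
have gr s : 0 <= s <= 1 -> `|x0 - g s| <= r.
  move=> /andP[s0 s1].
  have -> : x0 - g s = s *: (x0 - x) + (1 - s) *: (x0 - y).
    by apply/rowP => k; rewrite !mxE; ring.
  apply: le_trans (ler_normD _ _) _; rewrite !normrZ !ger0_norm ?subr_ge0//.
  have := ler_wpM2l s0 xr; have s1' : 0 <= 1 - s by rewrite subr_ge0.
  by have := ler_wpM2l s1' yr; nra.
have gd (s : R) : is_derive s (1 : R) g (x - y).
  have := is_deriveD (is_derive_cst y s (1 : R))
    (is_derive_rV (f := fun s => s *: (x - y)) (df := x - y) (t := s) _).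
  rewrite add0r; apply => k.
  rewrite (_ : (fun _ => _) = (fun z : R => (x - y) 0 k *: z)); last first.
    by apply/funext => z; rewrite !mxE /GRing.scale /= mulrC.
  by apply: is_derive_eq; rewrite /GRing.scale /= mulr1.
have := @derive_bounded_le R (fun s => b (g s) 0 j)
  (fun s => 'd b (g s) (x - y) 0 j) 0 1 (K * `|x - y|) ler01.
rewrite subr0 mulr1 /g scale1r scale0r addr0 (addrC y) subrK !mxE; apply.
- move=> s s01; apply: (is_derive_coord (f := b \o g)).
  apply: is_derive_diff_comp (gd s); have [/= bd _] := bC1; apply: bd.
  by case: (rP _ (gr s s01)).
- move=> s s01; apply: le_trans (rV_coord_le _ _) _.
  by case: (rP _ (gr s s01)).
Qed.

(** Precomposing b with the projection onto a small box gives a globally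
    Lipschitz field.  Its solution starts at the centre of the box, and as long
    as it stays inside it solves the original equation. *)
Theorem picard_lindelof : exists y : R -> 'rV[R]_n, y 0 = x0 /\
  \forall t \near (0 : R), A (y t) /\ is_derive t (1 : R) y (b (y t)).
Proof.
have [r r0 rP] := C1_locally_lipschitz.
(* Coordinatewise clamping projects onto the closed ball of the sup norm. *)
pose p (x : 'rV[R]_n) := x0 + \row_j clamp r ((x - x0) 0 j).
have pr x : `|x0 - p x| <= r.
  rewrite opprD addrA subrr add0r normrN; apply: rV_norm_le (ltW r0) _ => j.
  by rewrite mxE clamp_le// ltW.
have p_id x : `|x0 - x| <= r -> p x = x.
  move=> xr; apply/rowP => j; rewrite !mxE clamp_id; first by rewrite addrC subrK.
  by apply: le_trans xr; rewrite [leRHS]distrC; have := rV_coord_le (x - x0) j; rewrite !mxE.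
have p_dist x y : `|p x - p y| <= `|x - y|.
  apply: rV_norm_le => // j; rewrite !mxE opprD addrACA subrr add0r.
  apply: le_trans (clamp_dist _ _ (ltW r0)) _.
  have := rV_coord_le (x - y) j; rewrite !mxE; apply: le_trans.
  by rewrite opprB addrA subrK.
have Bl x y : `|b (p x) - b (p y)| <= K * `|x - y|.
  have [_] := rP _ _ (pr x) (pr y); move=> /le_trans; apply.
  by rewrite ler_wpM2l.
have [d d0 [y [y0 yd]]] := picard_lindelof_lipschitz x0 K_ge0 Bl.
exists y; split=> //.
have yc : {for 0, continuous y}.
  by apply/differentiable_continuous/derivable1_diffP; case: (yd 0 _) => //; rewrite normr0.
have yr : \forall t \near (0 : R), `|x0 - y t| <= r.
  by rewrite -y0; move/cvgrPdist_le : yc; apply.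
have td : \forall t \near (0 : R), `|t| < d.
  have nt : `|s| @[s --> (0 : R)] --> `|0 : R| by apply: cvg_norm; exact: cvg_id.
  by rewrite normr0 in nt; exact: (@cvgr_lt _ _ _ (nbhs_filter (0 : R)) _ _ nt _ d0).
near=> t.
have tr : `|x0 - y t| <= r by near: t.
split; first by have [] := rP _ _ tr tr.
by rewrite -[in X in is_derive _ _ _ X](p_id (y t))//; apply: yd; near: t.
Unshelve. all: by end_near. Qed.

End PicardLocal.

(** * Smooth functions and flows of vector fields *)

Section Smooth.
Context {R : realType} {V : normedModType R}.

Lemma is_diff_near0 (W : normedModType R) (e : V -> W) (x : V) :
  (\forall y \near x, e y = 0) -> is_diff x e (cst 0).
Proof.
move=> e0; have ex0 : e x = 0 := nbhs_singleton e0.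
have eo : e \o shift x = cst (e x) + (\0 : {linear V -> W}) +o_ 0 id.
  apply: eqaddoE; rewrite funeqE => y /=.
  rewrite ex0 !addr0 add0r.
  suff eo : e \o shift x =o_ 0 id by rewrite -[LHS]/((e \o shift x) y) eo.
  apply/eqoP => c c0; near=> z.
  suff -> : (e \o shift x) z = 0 by rewrite normr0 mulr_ge0// ltW.
  near: z.
  have sc : (shift x) @ (0 : V) --> (0 + x).
    by apply: cvgD; [exact: cvg_id|exact: cvg_cst].
  by rewrite add0r in sc; exact: (sc _ e0).
have c0 : continuous (\0 : V -> W) by move=> z; exact: cst_continuous.
have de : 'd e x = cst 0 :> (V -> W) by exact: (diff_unique c0 eo).
apply: DiffDef => //; apply/diff_locallyP; rewrite de; split => //.
Unshelve. all: by end_near. Qed.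

(** Differentials are local: the difference g - f vanishes near x, hence is
    little-o of anything and has differential 0. *)
Lemma near_eq_is_diff (W : normedModType R) (f g df : V -> W) (x : V) :
  (\forall y \near x, f y = g y) -> is_diff x f df -> is_diff x g df.
Proof.
move=> fg [fd fdE].
have [|ed edE] := @is_diff_near0 W (g - f) x.
  by apply: filterS fg => y fy; rewrite -[LHS]/(g y - f y) fy subrr.
have gE : g = f + (g - f) by rewrite addrC subrK.
rewrite gE; apply: DiffDef; first exact: differentiableD.
by rewrite diffD// fdE edE; apply/funext => v; rewrite -[LHS]/(df v + 0) addr0.
Qed.

Lemma open_near (A : set V) x : open A -> A x -> \forall y \near x, A y.
Proof. by move=> Ao Ax; apply: open_nbhs_nbhs. Qed.

Variable A : set V.
Hypothesis Aopen : open A.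

Lemma Ck_on_eq (W : normedModType R) k (f g : V -> W) :
  (forall x, A x -> f x = g x) -> Ck_on k A f -> Ck_on k A g.
Proof.
elim: k f g => [|k IH] f g fg /=.
  move=> fc x Ax; have := fc x Ax; rewrite /prop_for /continuous_at (fg x Ax).
  apply: cvg_trans; apply: near_eq_cvg.
  by apply: filterS (open_near Aopen Ax) => y Ay; rewrite fg.
move=> [fd fk].
have gd x : A x -> is_diff x g ('d f x).
  move=> Ax; apply: (@near_eq_is_diff _ f).
    by apply: filterS (open_near Aopen Ax) => y; exact: fg.
  exact/differentiableP/fd.
split=> [x Ax|v]; first by case: (gd x Ax).
by apply: IH (fk v) => x Ax; case: (gd x Ax) => _ ->.
Qed.

Lemma Ck_onW (W : normedModType R) k (f : V -> W) : Ck_on k.+1 A f -> Ck_on k A f.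
Proof.
elim: k f => [|k IH] f /= [fd fk].
  by move=> x Ax; apply: differentiable_continuous; exact: fd.
by split=> // v; apply: IH; exact: fk.
Qed.

Lemma Ck_on_cst (W : normedModType R) k (c : W) : Ck_on k A (cst c).
Proof.
elim: k c => [|k IH] c /=; first by move=> x _; exact: cst_continuous.
split=> [x _|v]; first exact: differentiable_cst.
by apply: (@Ck_on_eq _ _ (cst 0)) (IH 0) => x _; rewrite diff_cst.
Qed.

Lemma Ck_onD (W : normedModType R) k (f g : V -> W) :
  Ck_on k A f -> Ck_on k A g -> Ck_on k A (f + g).
Proof.
elim: k f g => [|k IH] f g /=.
  by move=> fc gc x Ax; apply: continuousD; [exact: fc|exact: gc].
move=> [fd fk] [gd gk]; split=> [x Ax|v].
  by apply: differentiableD; [exact: fd|exact: gd].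
apply: Ck_on_eq (IH _ _ (fk v) (gk v)) => x Ax.
by rewrite diffD//; [exact: fd|exact: gd].
Qed.

(** Product rule and induction on k; the undifferentiated factors are C^k by
    [Ck_onW]. *)
Lemma Ck_onM k (f g : V -> R) : Ck_on k A f -> Ck_on k A g -> Ck_on k A (f * g).
Proof.
elim: k f g => [|k IH] f g.
  by move=> fc gc x Ax; apply: continuousM; [exact: fc|exact: gc].
move=> fk1 gk1; have fk' := Ck_onW fk1; have gk' := Ck_onW gk1.
have [fd fk] := fk1; have [gd gk] := gk1; split=> [x Ax|v].
  by apply: differentiableM; [exact: fd|exact: gd].
apply: Ck_on_eq (Ck_onD (IH _ _ fk' (gk v)) (IH _ _ gk' (fk v))) => x Ax.
by rewrite diffM//; [exact: fd|exact: gd].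
Qed.

Lemma Ck_on_coord n k (f : V -> 'rV[R]_n) j :
  Ck_on k A f -> Ck_on k A (fun x => f x 0 j).
Proof.
pose c : 'rV[R]_n -> R := fun v => v 0 j.
have cd y : is_diff y c c.
  have cl : linear c by move=> k' u v; rewrite /c !mxE.
  pose cL : {linear 'rV[R]_n -> R} := HB.pack c (GRing.isLinear.Build _ _ _ _ _ cl).
  have cc : continuous cL by exact: coord_continuous.
  by apply: DiffDef; [exact: (@linear_differentiable _ _ _ cL y cc)|exact: (@diff_lin _ _ _ cL y cc)].
elim: k f => [|k IH] f /=.
  by move=> fc x Ax; apply: (@continuous_comp _ _ _ f c); [exact: fc|exact: coord_continuous].
move=> [fd fk]; split=> [x Ax|v].
  by apply: (@differentiable_comp _ _ _ _ f c); [exact: fd|case: (cd (f x))].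
apply: Ck_on_eq (IH _ (fk v)) => x Ax.
have [cdx cdE] := cd (f x).
have fdx := fd x Ax.
have dE := diff_comp fdx cdx; rewrite cdE in dE.
by rewrite -[LHS]/((c \o 'd f x) v) -dE.
Qed.

Lemma Ck_on_sum n k (f : 'I_n -> V -> R) :
  (forall j, Ck_on k A (f j)) -> Ck_on k A (fun x => \sum_j f j x).
Proof.
move=> fk; rewrite (_ : (fun _ => _) = \sum_j f j); last first.
  by apply/funext => x; rewrite fct_sumE.
by elim/big_ind : _ => [||j _]; [exact: Ck_on_cst|exact: Ck_onD|exact: fk].
Qed.

End Smooth.

(** In coordinates the directional derivative is the sum of b_j(x) times the
    j-th partial derivative of f. *)
Lemma Ck_on_diff (R : realType) n (A : set 'rV[R]_n) k (f : 'rV[R]_n -> R)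
    (b : 'rV[R]_n -> 'rV[R]_n) : open A ->
  Ck_on k.+1 A f -> Ck_on k A b -> Ck_on k A (fun x => 'd f x (b x)).
Proof.
move=> Ao [_ fk] bk.
have dE x : 'd f x (b x) = \sum_j b x 0 j *: 'd f x (delta_mx 0 j).
  exact: linear_row_sum.
have -> : (fun x => 'd f x (b x)) = (fun x => \sum_j b x 0 j *: 'd f x (delta_mx 0 j)).
  by apply/funext => x; exact: dE.
apply: Ck_on_sum => // j.
apply: (@Ck_onM _ _ _ Ao k (fun x => b x 0 j) (fun x => 'd f x (delta_mx 0 j))).
  exact: Ck_on_coord.
exact: fk.
Qed.

Section SmoothFunctions.
Context {R : realType} {n : nat} {M : topologicalType}.
Variable atlas : set (chart R n M).
Local Notation smooth := (smooth_fun atlas).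

Lemma smooth_cst (a : R) : smooth (cst a).
Proof.
move=> c _ k; have -> : cst a \o cpoint c = cst a by [].
exact/Ck_on_cst/chart_open_img.
Qed.

Lemma smooth_mul phi psi : smooth phi -> smooth psi -> smooth (phi * psi).
Proof.
move=> s1 s2 c ca k.
have -> : (phi * psi) \o cpoint c = (phi \o cpoint c) * (psi \o cpoint c) by [].
exact: Ck_onM (@chart_open_img _ _ _ c) _ _ _ (s1 c ca k) (s2 c ca k).
Qed.

Lemma smooth_vfield (X : vfield R M) phi : is_vfield atlas X -> smooth phi -> smooth (X phi).
Proof.
move=> [_ Xc] sphi c ca k; have [b bs bX] := Xc c ca.
have Ao := @chart_open_img _ _ _ c.
apply: (Ck_on_eq Ao _ (Ck_on_diff Ao (sphi c ca k.+1) (bs k))) => _ [p cp <-].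
by rewrite /= (chartK cp) -bX.
Qed.

Hypothesis hM : smooth_manifold atlas.

(** Solve the equation in a chart and push the solution to the manifold; the
    chain rule turns it into an integral curve. *)
Lemma integral_curve_exists (X : vfield R M) p : is_vfield atlas X ->
  exists gamma, integral_curve atlas X p gamma.
Proof.
move=> [_ Xc]; have [_ _ atl _] := hM; have [c ca cp] := atl p.
have [b bs bX] := Xc c ca; have Ao := @chart_open_img _ _ _ c.
have Ap : (ccoord c @` cdom c) (ccoord c p) by exists p.
have [y [y0 yn]] := picard_lindelof Ao Ap (bs 1%N).
exists (cpoint c \o y); split; first by rewrite /= y0 chartK.
apply: filterS yn => t [At yt].
have yc : {for t, continuous y}.
  by apply/differentiable_continuous/derivable1_diffP; case: yt.
split=> [|phi sphi].
  by apply: continuous_comp => //; exact: chart_continuousV.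
have [q cq qt] := At.
rewrite -[_ \o _]/((phi \o cpoint c) \o y) /= -qt (chartK cq) (bX _ _ sphi cq) qt.
apply: is_derive_diff_comp yt; have [/= sd _] := sphi c ca 1%N.
exact: sd.
Qed.

Lemma flow_integral_curve (X : vfield R M) p : is_vfield atlas X ->
  integral_curve atlas X p (flow atlas X p).
Proof.
by move=> Xv; exact: xgetPex (integral_curve_exists p Xv).
Qed.

Lemma flow0 (X : vfield R M) p : is_vfield atlas X -> flow atlas X p 0 = p.
Proof. by move=> /(flow_integral_curve p)[]. Qed.

Lemma flow_continuous (X : vfield R M) p : is_vfield atlas X ->
  flow atlas X p t @[t --> (0 : R)] --> p.
Proof.
move=> Xv; have [f0 /nbhs_singleton[fc _]] := flow_integral_curve p Xv.
by move: fc; rewrite /prop_for /continuous_at f0.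
Qed.

Lemma flow_derive (X : vfield R M) p phi : is_vfield atlas X -> smooth phi ->
  is_derive (0 : R) (1 : R) (phi \o flow atlas X p) (X phi p).
Proof.
move=> Xv sphi; have [f0 /nbhs_singleton[_ fd]] := flow_integral_curve p Xv.
by rewrite -[in X in is_derive _ _ _ X]f0; exact: fd.
Qed.

End SmoothFunctions.

(** * Derivatives of curves in an algebra *)

Section SplitSums.
Context {R : realType} {E : lmodType R}.

(** Concatenation of two finite families, used to add local expressions of the
    form sum_i c_i u_i. *)
Definition join_ord T m k (a : 'I_m -> T) (b : 'I_k -> T) (i : 'I_(m + k)) : T :=
  match fintype.split i with inl j => a j | inr j => b j end.

Lemma join_ordP T m k (a : 'I_m -> T) (b : 'I_k -> T) (P : T -> Prop) :
  (forall i, P (a i)) -> (forall i, P (b i)) -> forall i, P (join_ord a b i).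
Proof. by move=> Pa Pb i; rewrite /join_ord; case: fintype.split. Qed.

Lemma sum_join_ord m k (I J : Type) (a : 'I_m -> I) (b : 'I_k -> I) (u : 'I_m -> J)
    (v : 'I_k -> J) (G : I -> J -> E) :
  \sum_i G (join_ord a b i) (join_ord u v i) =
  \sum_i G (a i) (u i) + \sum_i G (b i) (v i).
Proof.
rewrite big_split_ord /=; congr (_ + _); apply: eq_bigr => i _.
  by rewrite /join_ord -[lshift _ _]/(unsplit (inl i)) unsplitK.
by rewrite /join_ord -[rshift _ _]/(unsplit (inr i)) unsplitK.
Qed.

End SplitSums.

Section CurveDerivative.
Context {R : realType}.
Implicit Types (E : lmodType R).

Lemma curve_derivative_near E (c d : R -> E) v :
  (\forall t \near (0 : R), c t = d t) -> curve_derivative c v -> curve_derivative d v.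
Proof.
move=> cd [m [a [u [ad ca ->]]]]; exists m, a, u; split=> //.
by apply: filterS2 cd ca => t ->.
Qed.

Lemma curve_derivative0 E : curve_derivative (fun=> 0 : E) 0.
Proof.
exists 0%N, (fun _ _ => 0), (fun=> 0).
split; [by case|by near=> t; rewrite big_ord0|by rewrite big_ord0].
Unshelve. all: by end_near. Qed.

Lemma curve_derivativeD E (c d : R -> E) v w :
  curve_derivative c v -> curve_derivative d w ->
  curve_derivative (fun t => c t + d t) (v + w).
Proof.
move=> [m [a [u [ad ca ->]]]] [k [b [x [bd db ->]]]].
exists (m + k)%N, (join_ord a b), (join_ord u x); split.
- exact: (join_ordP (P := fun h : R -> R => derivable h (0 : R) 1) ad bd).
- apply: filterS2 ca db => t -> ->.
  by rewrite (sum_join_ord a b u x (fun f y => f t *: y)).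
- by rewrite (sum_join_ord a b u x (fun f y => 'D_1 f 0 *: y)).
Qed.

Lemma curve_derivative_sum E m (c : 'I_m -> R -> E) v :
  (forall i, curve_derivative (c i) (v i)) ->
  curve_derivative (fun t => \sum_i c i t) (\sum_i v i).
Proof.
elim: m c v => [|m IH] c v cv.
  rewrite big_ord0 (_ : (fun _ => _) = fun=> 0); first exact: curve_derivative0.
  by apply/funext => t; rewrite big_ord0.
rewrite big_ord_recl (_ : (fun _ => _) = fun t => c ord0 t + \sum_i c (lift ord0 i) t); last first.
  by apply/funext => t; rewrite big_ord_recl.
by apply: curve_derivativeD => //; apply: IH.
Qed.

Lemma curve_derivativeZ E (k : R -> R) (c : R -> E) v :
  derivable k 0 1 -> curve_derivative c v ->
  curve_derivative (fun t => k t *: c t) ('D_1 k 0 *: c 0 + k 0 *: v).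
Proof.
move=> kd [m [a [u [ad ca ->]]]]; exists m, (fun i => k * a i), u; split.
- by move=> i; exact: derivableM kd (ad i).
- by apply: filterS ca => t ->; rewrite scaler_sumr; apply: eq_bigr => i _; rewrite scalerA.
- rewrite (nbhs_singleton ca) !scaler_sumr -big_split; apply: eq_bigr => i _.
  by rewrite (deriveM kd (ad i)) scalerDl !scalerA addrC [a i 0 *: _]mulrC.
Qed.

Lemma curve_derivative_linear E E' (h : {linear E -> E'}) (c : R -> E) v :
  curve_derivative c v -> curve_derivative (fun t => h (c t)) (h v).
Proof.
move=> [m [a [u [ad ca ->]]]]; exists m, a, (h \o u); split=> //.
- apply: filterS ca => t ->; rewrite linear_sum.
  by apply: eq_bigr => i _; rewrite linearZ.
- by rewrite linear_sum; apply: eq_bigr => i _; rewrite linearZ.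
Qed.

(** If the u_i are linearly independent then all coefficients vanish near 0.
    Otherwise one u_i is a combination of the others; eliminating it shortens
    the expression and changes both the curve and its derivative in the same
    linear way. *)
Lemma curve_derivative_near0 E (c : R -> E) v :
  (\forall t \near (0 : R), c t = 0) -> curve_derivative c v -> v = 0.
Proof.
move=> c0 [m [a [u [ad ca ->]]]].
have : \forall t \near (0 : R), \sum_(i < m) a i t *: u i = 0.
  by apply: filterS2 c0 ca => t ->.
elim: m a u ad {ca} => [|m IH] a u ad au0; first by rewrite big_ord0.
(* Either the u_i are free, or some relation has a nonzero coefficient at i0. *)
have [free|] := pselect (forall b : 'I_m.+1 -> R, \sum_i b i *: u i = 0 -> forall i, b i = 0).
  rewrite big1// => i _.
  rewrite (@near_eq_derive _ _ _ _ (cst 0)) ?derive_cst ?scale0r//.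
  by apply: filterS au0 => t /(free (a^~ t)).
move=> /existsNP[b /not_implyP[bu /existsNP[i0 /eqP bi0]]].
pose k i := b (lift i0 i) / b i0.
have uE : u i0 = - \sum_i k i *: u (lift i0 i).
  apply: (scalerI bi0); rewrite scalerN scaler_sumr.
  under eq_bigr => i _ do rewrite scalerA /k mulrC divfK//.
  by move: bu; rewrite (bigD1_ord i0)//= => /eqP; rewrite addr_eq0 => /eqP.
have elim_i0 (d : 'I_m.+1 -> R) : \sum_i d i *: u i =
    \sum_i (d (lift i0 i) - k i * d i0) *: u (lift i0 i).
  rewrite (bigD1_ord i0)//= uE scalerN scaler_sumr addrC -sumrB.
  by apply: eq_bigr => i _; rewrite scalerBl scalerA [d i0 * _]mulrC.
rewrite elim_i0.
have kad i : derivable (k i *: a i0) 0 1 := derivableZ (ad i0).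
transitivity (\sum_i 'D_1 (a (lift i0 i) - k i *: a i0) 0 *: u (lift i0 i)).
  apply: eq_bigr => i _; congr (_ *: _).
  by rewrite (deriveB (ad _) (kad i)) (deriveZ _ (ad i0)).
apply: (IH (fun i => a (lift i0 i) - k i *: a i0) (u \o lift i0)).
- by move=> i; exact: derivableB (ad _) (kad i).
- by apply: filterS au0 => t; rewrite elim_i0.
Qed.

(** The value of a curve derivative does not depend on the chosen expression
    of the curve, so that [lie_deriv] picks the right vector. *)
Lemma curve_derivative_unique E (c : R -> E) v w :
  curve_derivative c v -> curve_derivative c w -> v = w.
Proof.
move=> cv cw; apply/eqP; rewrite -subr_eq0; apply/eqP.
have cz : curve_derivative (fun t => - c t) (- w) := curve_derivative_linear -%R cw.
apply: curve_derivative_near0 (curve_derivativeD cv cz).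
by near=> t; rewrite subrr.
Unshelve. all: by end_near. Qed.

Lemma curve_derivativeM (U : algType R) (c d : R -> U) v w :
  curve_derivative c v -> curve_derivative d w ->
  curve_derivative (fun t => c t * d t) (v * d 0 + c 0 * w).
Proof.
move=> [m [a [u [ad ca ->]]]] dw.
have cdE : \forall t \near (0 : R), \sum_(i < m) a i t *: (u i * d t) = c t * d t.
  by apply: filterS ca => t ->; rewrite mulr_suml; apply: eq_bigr => i _; rewrite scalerAl.
apply: curve_derivative_near cdE _.
rewrite (nbhs_singleton ca) !mulr_suml -big_split /=.
apply: curve_derivative_sum => i; rewrite -!scalerAl; apply: curve_derivativeZ => //.
have ml : linear (fun x : U => u i * x) by move=> k x y; rewrite mulrDr scalerAr.
pose h : {linear U -> U} := HB.pack (fun x : U => u i * x) (GRing.isLinear.Build _ _ _ _ _ ml).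
exact: (curve_derivative_linear h dw).
Qed.

End CurveDerivative.

(** * Smooth maps and their Lie derivatives *)

Section SmoothMaps.
Context {R : realType} {n : nat} {M : topologicalType}.
Variable atlas : set (chart R n M).
Implicit Types (E : lmodType R).
Local Notation smooth := (smooth_fun atlas).
Local Notation smap := (smooth_map atlas).

(** Smoothness only needs to be checked against a comparison map near each point. *)
Lemma smooth_map_local E (S : set E) (Psi : M -> E) :
  (forall p : M, exists2 Phi, smap S Phi & \forall q \near p, Psi q = Phi q) ->
  smap S Psi.
Proof.
move=> loc p; have [Phi PhiS PsiE] := loc p.
have [m [c [u [cs uS PhiE]]]] := PhiS p; exists m, c, u; split=> //.
by apply: filterS2 PsiE PhiE => q ->.
Qed.

Lemma smooth_map_sub E (S T : set E) Psi : S `<=` T -> smap S Psi -> smap T Psi.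
Proof.
move=> ST PsiS p; have [m [c [u [cs uS PsiE]]]] := PsiS p.
by exists m, c, u; split=> // i; apply: ST.
Qed.

Lemma smooth_map0 E (S : set E) : smap S (fun=> 0).
Proof.
move=> p; exists 0%N, (fun _ _ => 0), (fun=> 0).
split; [by case|by case|by near=> t; rewrite big_ord0].
Unshelve. all: by end_near. Qed.

Lemma smooth_map_cst E (S : set E) u : S u -> smap S (fun=> u).
Proof.
move=> Su p; exists 1%N, (fun _ => cst 1), (fun=> u).
split=> // [_|]; first exact: smooth_cst.
by near=> t; rewrite big_ord1 scale1r.
Unshelve. all: by end_near. Qed.

Lemma smooth_mapD E (S : set E) Psi Phi :
  smap S Psi -> smap S Phi -> smap S (fun p => Psi p + Phi p).
Proof.
move=> PsiS PhiS p; have [m [c [u [cs uS PsiE]]]] := PsiS p.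
have [k [d [v [ds vS PhiE]]]] := PhiS p.
exists (m + k)%N, (join_ord c d), (join_ord u v); split.
- exact: join_ordP cs ds.
- exact: join_ordP uS vS.
apply: filterS2 PsiE PhiE => q -> ->.
by rewrite (sum_join_ord c d u v (fun f y => f q *: y)).
Qed.

Lemma smooth_mapZ E (S : set E) phi Psi :
  smooth phi -> smap S Psi -> smap S (fun p => phi p *: Psi p).
Proof.
move=> phis PsiS p; have [m [c [u [cs uS PsiE]]]] := PsiS p.
exists m, (fun i => phi * c i), u; split=> //.
  by move=> i; apply: smooth_mul.
apply: filterS PsiE => q ->; rewrite scaler_sumr.
by apply: eq_bigr => i _; rewrite scalerA.
Qed.

Lemma smooth_map_sum E (S : set E) m (Psi : 'I_m -> M -> E) :
  (forall i, smap S (Psi i)) -> smap S (fun p => \sum_i Psi i p).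
Proof.
elim: m Psi => [|m IH] Psi PsiS.
  rewrite (_ : (fun _ => _) = fun=> 0); first exact: smooth_map0.
  by apply/funext => p; rewrite big_ord0.
rewrite (_ : (fun _ => _) = fun p => Psi ord0 p + \sum_i Psi (lift ord0 i) p).
  by apply: smooth_mapD => //; exact: IH.
by apply/funext => p; rewrite big_ord_recl.
Qed.

Lemma smooth_map_linear E E' (S : set E) (T : set E') (h : {linear E -> E'}) Psi :
  (forall u, S u -> T (h u)) -> smap S Psi -> smap T (fun p => h (Psi p)).
Proof.
move=> ST PsiS p; have [m [c [u [cs uS PsiE]]]] := PsiS p.
exists m, c, (h \o u); split=> // [i|]; first exact: ST.
apply: filterS PsiE => q ->; rewrite linear_sum.
by apply: eq_bigr => i _; rewrite linearZ.
Qed.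

Lemma smooth_map_mul (U : algType R) (S T Q : set U) Psi Phi :
  (forall u v, S u -> T v -> Q (u * v)) ->
  smap S Psi -> smap T Phi -> smap Q (fun p => Psi p * Phi p).
Proof.
move=> STQ PsiS PhiT; apply: smooth_map_local => p.
have [m [c [u [cs uS PsiE]]]] := PsiS p.
exists (fun q => \sum_i c i q *: (u i * Phi q)).
  apply: smooth_map_sum => i; apply: smooth_mapZ => //.
  have ml : linear (fun x : U => u i * x) by move=> k x y; rewrite mulrDr scalerAr.
  pose h : {linear U -> U} := HB.pack (fun x : U => u i * x) (GRing.isLinear.Build _ _ _ _ _ ml).
  by apply: (smooth_map_linear (h := h)) PhiT => v; apply: STQ.
apply: filterS PsiE => q ->; rewrite mulr_suml.
by apply: eq_bigr => i _; rewrite scalerAl.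
Qed.

Hypothesis hM : smooth_manifold atlas.
Variable V : vfield R M.
Hypothesis Vfield : is_vfield atlas V.

Lemma curve_derivative_flow E (Psi : M -> E) p m (c : 'I_m -> M -> R) (u : 'I_m -> E) :
  (forall i, smooth (c i)) -> (\forall q \near p, Psi q = \sum_i c i q *: u i) ->
  curve_derivative (Psi \o flow atlas V p) (\sum_i V (c i) p *: u i).
Proof.
move=> cs PsiE; exists m, (fun i => c i \o flow atlas V p), u; split.
- by move=> i; case: (flow_derive hM p Vfield (cs i)).
- exact: (flow_continuous hM (p := p) Vfield PsiE).
- by apply: eq_bigr => i _; case: (flow_derive hM p Vfield (cs i)) => _ ->.
Qed.

Lemma lie_deriv_unique E (Psi : M -> E) p v :
  curve_derivative (Psi \o flow atlas V p) v -> lie_deriv atlas V Psi p = v.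
Proof.
move=> dv; apply: curve_derivative_unique (dv).
exact: (xgetPex 0 (ex_intro [set w | curve_derivative (Psi \o flow atlas V p) w] v dv)).
Qed.

Lemma lie_deriv_curve E (S : set E) (Psi : M -> E) p : smap S Psi ->
  curve_derivative (Psi \o flow atlas V p) (lie_deriv atlas V Psi p).
Proof.
move=> PsiS; have [m [c [u [cs uS PsiE]]]] := PsiS p.
have dv := curve_derivative_flow cs PsiE.
by rewrite (lie_deriv_unique dv).
Qed.

(** Near p the derivative of sum c_i u_i is sum V(c_i) u_i, and V(c_i) is a
    smooth function. *)
Lemma lie_deriv_smooth E (S : set E) (Psi : M -> E) :
  smap S Psi -> smap S (lie_deriv atlas V Psi).
Proof.
move=> PsiS p; have [m [c [u [cs uS PsiE]]]] := PsiS p.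
exists m, (fun i => V (c i)), u; split=> //.
  by move=> i; apply: smooth_vfield.
have := nbhs_interior PsiE; apply: filterS => q qE.
exact: lie_deriv_unique (curve_derivative_flow cs qE).
Qed.

Lemma lie_deriv_near E (S : set E) (Psi Phi : M -> E) p : smap S Psi ->
  (\forall q \near p, Psi q = Phi q) ->
  lie_deriv atlas V Phi p = lie_deriv atlas V Psi p.
Proof.
move=> PsiS PsiE; apply: lie_deriv_unique.
apply: curve_derivative_near (lie_deriv_curve p PsiS).
exact: (flow_continuous hM (p := p) Vfield PsiE).
Qed.

Lemma lie_derivD E (S : set E) (Psi Phi : M -> E) p : smap S Psi -> smap S Phi ->
  lie_deriv atlas V (fun q => Psi q + Phi q) p =
  lie_deriv atlas V Psi p + lie_deriv atlas V Phi p.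
Proof.
move=> PsiS PhiS; apply: lie_deriv_unique.
exact: curve_derivativeD (lie_deriv_curve p PsiS) (lie_deriv_curve p PhiS).
Qed.

Lemma lie_derivZ E (S : set E) phi (Psi : M -> E) p : smooth phi -> smap S Psi ->
  lie_deriv atlas V (fun q => phi q *: Psi q) p =
  V phi p *: Psi p + phi p *: lie_deriv atlas V Psi p.
Proof.
move=> phis PsiS; apply: lie_deriv_unique.
have [phid phiE] := flow_derive hM p Vfield phis.
have := curve_derivativeZ phid (lie_deriv_curve p PsiS).
by rewrite phiE /= (flow0 hM).
Qed.

Lemma lie_deriv_sumZ E (S : set E) m (c : 'I_m -> M -> R) (Psi : 'I_m -> M -> E) p :
  (forall i, smooth (c i)) -> (forall i, smap S (Psi i)) ->
  lie_deriv atlas V (fun q => \sum_i c i q *: Psi i q) p =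
  \sum_i (V (c i) p *: Psi i p + c i p *: lie_deriv atlas V (Psi i) p).
Proof.
move=> cs PsiS; apply: lie_deriv_unique.
apply: curve_derivative_sum => i; rewrite -(lie_derivZ p (cs i) (PsiS i)).
exact: lie_deriv_curve (smooth_mapZ (cs i) (PsiS i)).
Qed.

Lemma lie_deriv_mul (U : algType R) (S T : set U) (Psi Phi : M -> U) p :
  smap S Psi -> smap T Phi ->
  lie_deriv atlas V (fun q => Psi q * Phi q) p =
  lie_deriv atlas V Psi p * Phi p + Psi p * lie_deriv atlas V Phi p.
Proof.
move=> PsiS PhiS; apply: lie_deriv_unique.
have := curve_derivativeM (lie_deriv_curve p PsiS) (lie_deriv_curve p PhiS).
by rewrite /= (flow0 hM).
Qed.

End SmoothMaps.

(** * The D-algebra of differential operators *)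

Section Action.
Context {R : realType} {n : nat} {M : topologicalType}.
Variables (atlas : set (chart R n M)) (g : set (vfield R M)).
Hypotheses (hM : smooth_manifold atlas) (hg : lie_subalgebra atlas g).
Variables (U : algType R) (iota : vfield R M -> U).
Hypothesis iota_lin : forall (a : R) X Y, g X -> g Y ->
  iota (a *: X + Y) = a *: iota X + iota Y.

Local Notation rho := (uact atlas g iota).
Local Notation mact := (mact atlas g iota).
Local Notation smap := (smooth_map atlas).
Local Notation mmul := (@mmul R M U).

Hypothesis uactP : is_action atlas g iota rho.

(** The span of the products of elements of g is the subalgebra they generate,
    on which the action is explicit: iterated Lie derivatives. *)
Inductive monomial : U -> Prop :=
| monomial1 : monomial 1
| monomialM V u : g V -> monomial u -> monomial (iota V * u).

Lemma monomial_mul u v : monomial u -> monomial v -> monomial (u * v).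
Proof.
elim=> [|V w gV _ IH] mv; first by rewrite mul1r.
by rewrite -mulrA; apply: monomialM => //; exact: IH.
Qed.

Lemma monomial_iota V : g V -> monomial (iota V).
Proof. by move=> gV; rewrite -[iota V]mulr1; apply: monomialM => //; exact: monomial1. Qed.

Definition diffops : set (M -> U) := smap monomial.
Definition derivations : set (M -> U) := smap (iota @` g).

Lemma g_field V : g V -> is_vfield atlas V.
Proof. by case: hg => + _ _ _; apply. Qed.

Lemma iota0 : iota 0 = 0.
Proof.
have [_ g0 _ _] := hg; have := iota_lin (-1) g0 g0.
by rewrite scaler0 addr0 scaleN1r addNr.
Qed.

Lemma smooth_mapT (S : set U) Psi : smap S Psi -> smap setT Psi.
Proof. exact: smooth_map_sub. Qed.

Lemma uact0 Psi : smap setT Psi -> rho 0 Psi = 0.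
Proof.
move=> Ps; have := action_lin uactP (-1) 0 0 Ps.
by rewrite scaler0 addr0 scaleN1r addNr.
Qed.

Lemma uact_sum m (a : 'I_m -> R) (w : 'I_m -> U) Psi p : smap setT Psi ->
  rho (\sum_i a i *: w i) Psi p = \sum_i a i *: rho (w i) Psi p.
Proof.
move=> Ps; elim: m a w => [|m IH] a w; first by rewrite !big_ord0 uact0.
by rewrite !big_ord_recl (action_lin uactP)// -IH.
Qed.

(** The action of a product of fields is an iterated Lie derivative, so it
    preserves every class of smooth maps, in particular the g-valued ones. *)
Lemma uact_smooth (S : set U) u Psi : monomial u -> smap S Psi -> smap S (rho u Psi).
Proof.
move=> mu PsiS; elim: mu => [|V w gV _ IH].
  by rewrite (action_one uactP)//; exact: smooth_mapT PsiS.
rewrite (action_mul uactP); last exact: smooth_mapT PsiS.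
rewrite (action_vfield uactP)//; last exact: smooth_mapT IH.
by have := lie_deriv_smooth hM (g_field gV) IH.
Qed.

(** Linearity in the function argument is inherited from the Lie derivative. *)
Lemma uact_lin u (a : R) Psi Phi : monomial u -> smap setT Psi -> smap setT Phi ->
  rho u (a *: Psi + Phi) = a *: rho u Psi + rho u Phi.
Proof.
move=> mu Ps Qs; have aPs : smap setT (a *: Psi) by apply: smooth_mapZ Ps; exact: smooth_cst.
have PQs : smap setT (a *: Psi + Phi) by exact: smooth_mapD.
elim: mu => [|V w gV mw IH]; first by rewrite !(action_one uactP).
rewrite !(action_mul uactP)// IH.
have Ps' := uact_smooth mw Ps; have Qs' := uact_smooth mw Qs.
have aPs' : smap setT (a *: rho w Psi) by apply: smooth_mapZ Ps'; exact: smooth_cst.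
have PQs' : smap setT (a *: rho w Psi + rho w Phi) by exact: smooth_mapD.
rewrite !(action_vfield uactP)//; apply/funext => p.
rewrite (lie_derivD hM (g_field gV) p aPs' Qs'); congr (_ + _).
have := lie_derivZ hM (g_field gV) p (@smooth_cst _ _ _ atlas a) Ps'.
move=> ->; rewrite [X in X *: _](_ : _ = 0) ?scale0r ?add0r//.
have [_ <-] := flow_derive hM p (g_field gV) (@smooth_cst _ _ _ atlas a).
exact: derive_cst.
Qed.

Lemma mact_smooth (S : set U) G K : diffops G -> smap S K -> smap S (mact G K).
Proof.
move=> Gs Ks; apply: smooth_map_local => p; have [m [c [w [cs ws GE]]]] := Gs p.
exists (fun q => \sum_i c i q *: rho (w i) K q).
  by apply: smooth_map_sum => i; apply: smooth_mapZ => //; exact: uact_smooth.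
by apply: filterS GE => q; rewrite /Defs.mact => ->; rewrite uact_sum//; exact: smooth_mapT Ks.
Qed.

(** A combination of elements of g is in g, and iota is linear. *)
Lemma derivationsP G : derivations G -> forall p, exists2 V, g V & G p = iota V.
Proof.
move=> Gs p; have [m [c [u [_ us /nbhs_singleton ->]]]] := Gs p.
have [_ g0 glin _] := hg.
elim: m c u us => [|m IH] c u us; first by exists 0; rewrite ?big_ord0 ?iota0.
have [V gV VE] := us ord0.
have [W gW WE] := IH (fun i => c (lift ord0 i)) _ (fun i => us (lift ord0 i)).
exists (c ord0 p *: V + W); first exact: glin.
by rewrite big_ord_recl iota_lin// VE -WE.
Qed.

Lemma derivations_diffops : derivations `<=` diffops.
Proof.
by move=> G; apply: smooth_map_sub => _ [V gV <-]; exact: monomial_iota.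
Qed.

Lemma mact_derivation d K p V : d p = iota V -> g V -> smap setT K ->
  mact d K p = lie_deriv atlas V K p.
Proof. by move=> dV gV Ks; rewrite /Defs.mact dV (action_vfield uactP). Qed.

(** The Leibniz axiom is the product rule for Lie derivatives.  For the other one
    write x = sum c_i w_i near p, with w_i products of fields: then
    V[x[y]] = sum V(c_i) w_i[y] + sum c_i V[w_i[y]], and the two sums are (V[x])[y]
    and (V x)[y]. *)
Lemma diffops_dalgebra : dalgebra diffops derivations (fun=> 1) mmul mact.
Proof.
have Alin (c : R) x y : diffops x -> diffops y -> diffops (c *: x + y).
  move=> xs ys; apply: smooth_mapD ys; apply: smooth_mapZ xs; exact: smooth_cst.
have mulA x y : diffops x -> diffops y -> diffops (mmul x y).
  by move=> xs ys; apply: smooth_map_mul xs ys => u v; exact: monomial_mul.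
split.
- by split; [exact: smooth_map0|exact: Alin].
- exact: derivations_diffops.
- by apply: smooth_map_cst; exact: monomial1.
- exact: mulA.
- by move=> x y xs ys; exact: mact_smooth.
- by move=> x d xs ds; exact: mact_smooth.
- exact: mmul_bilinear.
- split=> c x y z xs ys zs; apply/funext => p; rewrite /Defs.mact.
    by rewrite (action_lin uactP)//; exact: smooth_mapT zs.
  rewrite -[RHS]/(c *: rho (z p) x p + rho (z p) y p).
  have [m [a [w [_ ws /nbhs_singleton ->]]]] := zs p.
  rewrite !uact_sum;
    try by [exact: smooth_mapT xs|exact: smooth_mapT ys|exact: smooth_mapT (Alin c x y xs ys)].
  rewrite scaler_sumr -big_split; apply: eq_bigr => i _.
  rewrite uact_lin//; [|exact: smooth_mapT xs|exact: smooth_mapT ys].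
  by rewrite -[X in _ *: X]/(c *: rho (w i) x p + rho (w i) y p) scalerDr !scalerA mulrC.
- by move=> x y z _ _ _; apply/funext => p; rewrite /Defs.mmul mulrA.
- by move=> x _; apply/funext => p; rewrite /Defs.mmul mul1r.
- by move=> x _; apply/funext => p; rewrite /Defs.mmul mulr1.
- by move=> x xs; apply/funext => p; rewrite /Defs.mact (action_one uactP)//; exact: smooth_mapT xs.
- move=> d x y ds xs ys; apply/funext => p; have [V gV dV] := derivationsP ds p.
  rewrite -[RHS]/(mact d x p * y p + x p * mact d y p).
  rewrite !(mact_derivation dV gV);
    try by [exact: smooth_mapT xs|exact: smooth_mapT ys|exact: smooth_mapT (mulA x y xs ys)].
  by have := lie_deriv_mul hM (g_field gV) p xs ys.
- move=> d x y ds xs ys; apply/funext => p; have [V gV dV] := derivationsP ds p.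
  have Vf := g_field gV; have yT := smooth_mapT ys.
  have [m [c [w [cs ws xE]]]] := xs p.
  have rs i : smap monomial (rho (w i) y) by exact: uact_smooth.
  have xyE : \forall q \near p, \sum_i c i q *: rho (w i) y q = mact x y q.
    by apply: filterS xE => q; rewrite /Defs.mact => ->; rewrite uact_sum.
  have crs : smap monomial (fun q => \sum_i c i q *: rho (w i) y q).
    by apply: smooth_map_sum => i; apply: smooth_mapZ.
  rewrite (mact_derivation dV gV); last exact: smooth_mapT (mact_smooth xs ys).
  rewrite (lie_deriv_near hM Vf crs xyE) (lie_deriv_sumZ hM Vf p cs rs).
  rewrite -[RHS]/(rho (d p * x p) y p + rho (mact d x p) y p).
  rewrite (mact_derivation dV gV (smooth_mapT xs)) dV.
  rewrite (lie_deriv_unique (curve_derivative_flow hM Vf cs xE)) uact_sum//.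
  rewrite big_split addrC; congr (_ + _).
  rewrite (nbhs_singleton xE) mulr_sumr.
  under [in RHS]eq_bigr do rewrite -scalerAr.
  rewrite uact_sum//; apply: eq_bigr => i _; congr (_ *: _).
  by rewrite (action_mul uactP)// (action_vfield uactP)//; exact: smooth_mapT (rs i).
Qed.

Lemma iota_derivations f : smap g f -> derivations (iota \o f).
Proof.
move=> fs p; have [m [c [u [cs us fE]]]] := fs p.
exists m, c, (iota \o u); split=> // [i|]; first by exists (u i).
have [_ g0 glin _] := hg.
apply: filterS fE => q /= ->.
suff [] : g (\sum_i c i q *: u i) /\
   iota (\sum_i c i q *: u i) = \sum_i c i q *: iota (u i) by [].
elim: m c u us {cs} => [|m IH] c u us; first by rewrite !big_ord0 iota0.
rewrite !big_ord_recl; have [gs <-] := IH (fun i => c (lift ord0 i)) _ (fun i => us (lift ord0 i)).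
by split; [exact: glin|rewrite iota_lin].
Qed.

End Action.

(** * The substitution theorem *)

Theorem theorem3p2 (R : realType) (n : nat) (M : topologicalType)
    (atlas : set (chart R n M)) (hM : smooth_manifold atlas)
    (g : set (vfield R M)) (hg : lie_subalgebra atlas g)
    (U : algType R) (iota : vfield R M -> U) (hU : enveloping_algebra g iota)
    (f : M -> vfield R M) (hf : smooth_map atlas g f)
    (beta : oforest -> R) (hbeta : lie_series beta) (alpha : oforest -> R) :
  hLB atlas g iota (LB atlas g iota f beta) alpha
  = LB atlas g iota f (subst beta alpha).
Proof.
have beta0 := lie_series_nil hbeta.
have iota_lin : forall (a : R) X Y, g X -> g Y ->
    iota (a *: X + Y) = a *: iota X + iota Y by case: hU => -[].
have [[rho rhoP]|noact] := pselect (exists rho, is_action atlas g iota rho).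
  have actP : is_action atlas g iota (uact atlas g iota).
    exact: xgetPex (ex_intro [set r | is_action atlas g iota r] rho rhoP).
  have D := diffops_dalgebra hM hg iota_lin actP.
  have Lf := iota_derivations hg iota_lin hf.
  have Fcons := eldiff_cons atlas g iota f; have Ftree := eldiff_tree1 atlas g iota f.
  have [_ FA] := elementary_closed D Lf erefl Fcons Ftree.
  apply: (LB_substitution (dalg_subspace D) (dalg_op_bilinear D) FA) beta0 _.
  by move=> x y _; exact: (eval_deg_grafting D Lf erefl Fcons Ftree (grafting_basisP R)).
(* Without an action of U(g), uact is zero by definition. Then F(w) and
   F(x)[F(w)] vanish for every nonempty w, and grafting on a nonempty word only
   yields nonempty words. *)
have act0 : uact atlas g iota = fun _ _ => 0.
  by apply: xgetPN => r rP; apply: noact; exists r.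
have mact0 G K : mact atlas g iota G K = 0 by apply/funext => p; rewrite /mact act0.
have F0 w : w != [::] -> eldiff atlas g iota f w = 0.
  case: w => [//|[v] w] _; rewrite eldiff_cons eldiff_tree1 mact0.
  by apply/funext => p; rewrite /mmul mul0r.
apply: (@LB_substitution _ _ _ _ _ _ _ _ setT) beta0 _ => //.
- split=> c x y z _ _ _; rewrite !mact0; first by rewrite scaler0 addr0.
  by rewrite scaler0 addr0.
- move=> x y ny; rewrite mact0 /eval_deg big1// => w _.
  have [/(grafting_support (grafting_basisP R))[wy _]|] :=
    boolP (grafting_basis R x y w != 0); last first.
    by rewrite negbK => /eqP ->; rewrite scale0r.
  by rewrite F0 ?scaler0// -size_eq0 wy size_eq0.
Qed.
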